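(* Let $G$ be a graph of order $n$ such that every component of $G$ and every component of its complement $\overline{G}$ has order at least $3$. Then $\gamma_P(G)\cdot\gamma_P(\overline{G})\le 2\left\lfloor\frac{n}{3}\right\rfloor$ if at least one of the following is true: (1) $\operatorname{diam}(G)\ge 3$ or $\operatorname{diam}(\overline{G})\ge 3$; (2) $G$ or $\overline{G}$ is planar; (3) $\kappa(G)\le 3$ or $\kappa(\overline{G})\le 3$; (4) $G$ or $\overline{G}$ is not super-$\lambda$.
   Context: All graphs are finite, simple, undirected, with nonempty vertex set; the order is the number of vertices. $N(v)$ is the set of neighbors of $v$, $N[v]=N(v)\cup\{v\}$, and $N[S]=\bigcup_{v\in S}N[v]$. For $S\subseteq V(G)$, define $PD(S)$ by: (1) start with $PD(S):=N[S]$; (2) while there exists $v\in PD(S)$ with $|N(v)\setminus PD(S)|=1$, set $PD(S):=PD(S)\cup N(v)$. $S$ is a power dominating set if $PD(S)=V(G)$ at the end of the process. The power domination number $\gamma_P(G)$ is the minimum cardinality of a power dominating set of $G$. $\operatorname{diam}(G)$ is the maximum distance between two vertices of $G$ if $G$ is connected, and $\operatorname{diam}(G)=\infty$ if $G$ is not connected. $\delta(G)$ is the minimum degree of $G$. $\kappa(G)$ is the vertex-connectivity: the minimum cardinality of a set of vertices whose removal disconnects $G$ for $G\ne K_n$ (so $\kappa(G)=0$ if $G$ is disconnected), and $\kappa(K_n)=n-1$. An edge-cut is a set of edges whose removal disconnects $G$; the edge-connectivity $\lambda(G)$ is the minimum cardinality of an edge-cut. $G$ is maximally connected if $\kappa(G)=\lambda(G)=\delta(G)$.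 A minimum edge-cut is trivial if it is the set of all edges incident with some vertex $v$ of degree $\delta(G)$ (so its removal leaves a component consisting of one isolated vertex). A graph is super-$\lambda$ if it is maximally connected and every minimum edge-cut is trivial. *)

(* Defs.v *)
From mathcomp Require Import all_boot all_order all_algebra.
From mathcomp Require Import boolp classical_sets reals topology normedtype.

Set Implicit Arguments.
Unset Strict Implicit.
Unset Printing Implicit Defensive.

Import numFieldNormedType.Exports.

(* A graph is a relation [e] on a finite vertex type [T]; symmetry,            *)
(* irreflexivity and nonemptiness of [T] are hypotheses of the theorem.        *)

Section Graphs.
Variables (T : finType) (e : rel T).
Implicit Types (u v x y : T) (S P X : {set T}) (F : {set {set T}}).

Definition compl_graph : rel T := [rel x y | (x != y) && ~~ e x y].

Definition neigh v : {set T} := [set u | e v u].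
Definition closed_neigh v : {set T} := v |: neigh v.
Definition closed_neigh_set S : {set T} := \bigcup_(v in S) closed_neigh v.

Definition component v : {set T} := [set u | connect e v u].
Definition connected_graph : bool := [forall x, forall y, connect e x y].
Definition complete_graph : bool := [forall x, forall y, (x != y) ==> e x y].

(* One pass through the body of the while loop: [pick] selects an arbitrary    *)
(* vertex able to force, and the set is unchanged once there is none.          *)
Definition pd_step P : {set T} :=
  if [pick v in P | #|neigh v :\: P| == 1] is Some v then P :|: neigh v else P.

(* Every effective pass adds exactly one vertex, so #|T| passes are enough     *)
(* for the loop to terminate.                                                  *)
Definition PD S : {set T} := iter #|T| pd_step (closed_neigh_set S).

Definition power_dominating S : bool := PD S == [set: T].

Definition power_domination_number : nat :=
  #|[arg min_(S < [set: T] | power_dominating S) #|S|]|.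

Definition walk_of_length x y (k : nat) : bool :=
  [exists p : k.-tuple T, path e x p && (last x p == y)].

(* When x and y are connected, this is the least length of a walk from x to y; *)
(* such a walk has length less than #|T|. The value #|T| is junk otherwise.    *)
Definition dist x y : nat := find (walk_of_length x y) (iota 0 #|T|).

(* [None] stands for an infinite diameter. *)
Definition diam : option nat :=
  if connected_graph then Some (\max_(x : T) \max_(y : T) dist x y) else None.

(* The default value #|T| exceeds every degree. *)
Definition min_degree : nat := \big[minn/#|T|]_(v : T) #|neigh v|.

Definition delete_vertices X : rel T :=
  [rel x y | [&& e x y, x \notin X & y \notin X]].

Definition vertex_cut X : bool :=
  [exists x in ~: X, exists y in ~: X, ~~ connect (delete_vertices X) x y].

(* A graph that is not complete has a vertex cut, and all of its vertex cuts   *)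
(* have fewer than #|T| elements, so the default #|T| is never attained.       *)
Definition vertex_connectivity : nat :=
  if complete_graph then #|T|.-1
  else \big[minn/#|T|]_(X : {set T} | vertex_cut X) #|X|.

Definition edge_set : {set {set T}} :=
  [set E : {set T} | [exists x, exists y, e x y && (E == [set x; y])]].

Definition delete_edges F : rel T :=
  [rel x y | e x y && ([set x; y] \notin F)].

Definition edge_cut F : bool :=
  (F \subset edge_set) &&
  ~~ [forall x, forall y, connect (delete_edges F) x y].

(* The default is the size of the whole edge set, which is an edge cut as soon *)
(* as there are two vertices.                                                  *)
Definition edge_connectivity : nat :=
  \big[minn/#|edge_set|]_(F : {set {set T}} | edge_cut F) #|F|.

Definition minimum_edge_cut F : bool :=
  edge_cut F && (#|F| == edge_connectivity).

Definition trivial_edge_cut F : bool :=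
  [exists v, (#|neigh v| == min_degree) &&
             (F == [set E in edge_set | v \in E])].

Definition maximally_connected : bool :=
  (vertex_connectivity == edge_connectivity) &&
  (edge_connectivity == min_degree).

Definition super_lambda : bool :=
  maximally_connected &&
  [forall F : {set {set T}}, minimum_edge_cut F ==> trivial_edge_cut F].

End Graphs.

Definition diam_ge (d : option nat) (k : nat) : bool :=
  if d is Some m then k <= m else true.

Section Planarity.
Variable R : realType.
Local Open Scope classical_set_scope.
Local Open Scope ring_scope.

Definition is_arc (A : set (R * R)) (a b : R * R) : Prop :=
  exists f : R -> R * R,
    [/\ {within `[0, 1], continuous f},
        {in `[0, 1] &, injective f},
        f 0 = a, f 1 = b & f @` `[0, 1] = A].

(* [pos] places the vertices in the plane and [draw u v] is the arc            *)
(* representing the edge {u, v}.                                               *)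
Definition planar (T : finType) (e : rel T) : Prop :=
  exists (pos : T -> R * R) (draw : T -> T -> set (R * R)),
    [/\ injective pos,
        forall u v, draw u v = draw v u,
        forall u v, e u v -> is_arc (draw u v) (pos u) (pos v),
        forall u v w, e u v -> draw u v (pos w) -> w = u \/ w = v
      & forall u v x y, e u v -> e x y -> [set u; v]%SET <> [set x; y]%SET ->
          draw u v `&` draw x y `<=` range pos].

End Planarity.

(* Main.v *)
(* A set S fails to power dominate iff some fort W (a nonempty set such that no vertex outside W    *)
(* has exactly one neighbour in W) avoids N[S].  In a minimum power dominating set with as few      *)
(* isolated vertices and leaves as possible, every vertex has two private neighbours, whence        *)
(* gamma_P <= n/3 on both sides; this settles the case where one of the two numbers is at most 2.   *)
(* Otherwise put a = gamma_P(G) >= 3 and b = gamma_P(G^c) >= 3.  Any a - 1 vertices have at least   *)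
(* two common non-neighbours, which are twins if there are only two, and any b - 1 vertices have    *)
(* at least two common neighbours, with the same proviso.  A double count then bounds from below    *)
(* the common neighbourhood of j vertices in terms of that of j + 1 vertices; iterated down to      *)
(* j = 0 it shows that n is too large for a * b > 2 * (n / 3), except when a = b = 3 and n <= 14.   *)
(* In this last case all degrees are 6 or 7, every vertex has exactly one twin, and the quotient by *)
(* twins would be a 3-regular graph on 7 vertices.                                                  *)

Require Import Defs.
From mathcomp Require Import all_boot.
From mathcomp Require Import zify ring.

Set Implicit Arguments.
Unset Strict Implicit.
Unset Printing Implicit Defensive.

(** * Forts *)

(** The argument is translated into common neighbourhoods. A set too small to power dominate misses
    a fort ([power_dominatingPn]), and vertices missed by a set are its common neighbours in the
    complement; [rich_of_power_domination] thus makes both graphs [rich], each with a parameter one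
    below the power domination number of the other.

    The two conditions feed each other. If Z is the common neighbourhood of J in one graph, a small
    subset of Z has a common neighbour x in the other graph, and the common neighbourhood of J and x
    avoids that subset. So Z is larger than what is known for one more vertex: [common_grow] uses a
    single subset and gains a constant, [count_common] averages over all subsets of size i and gains
    a factor. For empty J the set Z is the whole vertex set, and [rich_product] compares its size
    with n, by evaluation for small parameters and by exponential growth for large ones.

    Counting does not exclude the pair (3, 3) for n at most 14; there [not_rich_three_three] shows
    that twins match up the vertices and concludes by parity. If one number is at most 2,
    [power_domination_number_third] bounds the other. *)

Definition fort (T : finType) (e : rel T) (W : {set T}) : bool :=
  (W != set0) && [forall v in ~: W, #|neigh e v :&: W| != 1].

Section Forts.
Variables (T : finType) (e : rel T).
Implicit Types (S P W : {set T}) (u v w x : T).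

Lemma closed_neigh_setP S x :
  reflect (exists2 v, v \in S & (x == v) || e v x) (x \in closed_neigh_set e S).
Proof.
by apply: (iffP bigcupP) => -[v vS xv]; exists v => //; move: xv; rewrite !inE.
Qed.

Lemma pd_step_sub P : P \subset pd_step e P.
Proof. by rewrite /pd_step; case: pickP => // v _; exact: subsetUl. Qed.

Lemma pd_step_stuck P : pd_step e P = P -> {in P, forall v, #|neigh e v :\: P| != 1}.
Proof.
rewrite /pd_step; case: pickP => [v /andP[vP /eqP c1] eqP' v' _|H _ v vP].
- have sub : neigh e v \subset P by rewrite -eqP' subsetUr.
  by move: c1; rewrite (eqP (_ : neigh e v :\: P == set0)) ?cards0 // setD_eq0.
- by have := H v; rewrite vP /= => ->.
Qed.

Lemma PD_stuck S : pd_step e (PD e S) = PD e S.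
Proof.
apply/eqP; rewrite eqEsubset pd_step_sub andbT.
(* After k passes the process is either stuck or has observed at least k vertices, so it is stuck
   after #|T| passes. *)
have grow k : (pd_step e (iter k (pd_step e) (closed_neigh_set e S))
                \subset iter k (pd_step e) (closed_neigh_set e S))
              || (k <= #|iter k (pd_step e) (closed_neigh_set e S)|).
  elim: k => [|k]; first by rewrite orbT.
  set P := iter k _ _; rewrite [iter k.+1 _ _]iterS -/P.
  have [sub|nsub] /= := boolP (pd_step e P \subset P).
    have -> : pd_step e P = P by apply/eqP; rewrite eqEsubset sub pd_step_sub.
    by rewrite sub.
  move=> le_kP; apply/orP; right; apply: leq_ltn_trans le_kP _.
  by apply: proper_card; rewrite properE pd_step_sub nsub.
have /orP[//|full] := grow #|T|.
have -> : PD e S = [set: T] by apply/eqP; rewrite eqEcard subsetT cardsT.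
exact: subsetT.
Qed.

Lemma closed_neigh_set_PD S : closed_neigh_set e S \subset PD e S.
Proof.
rewrite /PD; elim: #|T| => [|k IHk] //=.
exact: subset_trans IHk (pd_step_sub _).
Qed.

(** A forcing vertex has one unobserved neighbour, hence at most one neighbour in the still
    unobserved [W]; being outside the fort it has none, so what it forces is not in [W]. *)
Lemma PD_fort S W : fort e W -> [disjoint closed_neigh_set e S & W] ->
  [disjoint PD e S & W].
Proof.
move=> /andP[_ /forall_inP fW] dis; rewrite /PD; elim: #|T| => [|k] //=.
set P := iter k _ _ => disP; rewrite /pd_step; case: pickP => // v /andP[vP /eqP c1].
have nW u : u \in P -> u \notin W by move=> uP; rewrite (disjointFr disP).
rewrite -setI_eq0 setIUl (eqP (_ : P :&: W == set0)) ?setI_eq0 // set0U.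
have := fW v; rewrite inE nW // => /(_ isT).
have : #|neigh e v :&: W| <= 1.
  rewrite -c1; apply: subset_leq_card; apply/subsetP => u; rewrite inE => /andP[uv uW].
  by rewrite inE uv andbT; apply: contraTN uW => /nW.
by rewrite leq_eqVlt => /orP[->//|]; rewrite ltnS leqn0 cards_eq0.
Qed.

Lemma power_dominatingPn S :
  reflect (exists2 W, fort e W & [disjoint closed_neigh_set e S & W])
          (~~ power_dominating e S).
Proof.
apply: (iffP idP) => [npd|[W fW dis]].
- exists (~: PD e S); last by rewrite disjoints_subset setCK closed_neigh_set_PD.
  rewrite /fort -setCT (inj_eq (@setC_inj _)) npd /=; apply/forall_inP => v.
  by rewrite setCK -setDE; apply: pd_step_stuck (PD_stuck S) v.
- have := PD_fort fW dis; apply: contraL => /eqP ->.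
  case/andP: fW => /set0Pn[w wW] _.
  by apply/negP => /pred0P/(_ w); rewrite /= inE wW.
Qed.

Lemma power_dominatingP S :
  reflect (forall W, fort e W -> exists2 w, w \in W & w \in closed_neigh_set e S)
          (power_dominating e S).
Proof.
apply: (iffP idP) => [pd W fW|H].
- apply/exists_inP; apply: contraTT pd; rewrite negb_exists_in => /forall_inP H.
  apply/power_dominatingPn; exists W => //; rewrite disjoint_sym.
  by apply/pred0P => w /=; apply/andP => -[/H/negPf ->].
- apply: contraT => /power_dominatingPn[W /H[w wW wS] dis].
  by rewrite (disjointFr dis wS) in wW.
Qed.

Lemma power_dominatingT : power_dominating e [set: T].
Proof.
apply/power_dominatingP => W /andP[/set0Pn[w wW] _]; exists w => //.
by apply/closed_neigh_setP; exists w; rewrite ?eqxx.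
Qed.

Lemma power_domination_number_le S :
  power_dominating e S -> power_domination_number e <= #|S|.
Proof.
move=> pd; rewrite /power_domination_number.
by case: arg_minnP => [|S' _ -> //]; exact: power_dominatingT.
Qed.

Lemma power_domination_number_witness :
  exists2 S, power_dominating e S & #|S| = power_domination_number e.
Proof.
rewrite /power_domination_number.
by case: arg_minnP => [|S pd _]; [exact: power_dominatingT | exists S].
Qed.

End Forts.

(** * The bound n/3 *)

Section OneThird.
Variables (T : finType) (e : rel T).
Hypotheses (e_sym : symmetric e) (e_irr : irreflexive e).
Hypothesis comp3 : forall v, 3 <= #|component e v|.
Implicit Types (S W : {set T}) (u v w x : T).

Definition private S v := neigh e v :\: closed_neigh_set e (S :\ v).
Definition isolated_in S := [set x in S | neigh e x :&: S == set0].
Definition leaves_in S := [set x in S | #|neigh e x| == 1].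

Lemma mem_closed_neigh S x : x \in S -> x \in closed_neigh_set e S.
Proof. by move=> xS; apply/closed_neigh_setP; exists x; rewrite ?eqxx. Qed.

Lemma privateP S v w : v \in S -> w \in private S v ->
  [/\ e v w, w \notin S & forall u, u \in S -> e u w -> u = v].
Proof.
move=> vS; rewrite !inE => /andP[wN vw]; split=> // [|u uS uw].
- apply: contra wN => wS; apply: mem_closed_neigh; rewrite !inE wS andbT.
  by apply: contraTneq vw => ->; rewrite e_irr.
- apply/eqP; apply: contraR wN => uv; apply/closed_neigh_setP.
  by exists u; rewrite ?inE ?uv ?uw ?orbT.
Qed.

Lemma exists_neigh v : exists u, u \in neigh e v.
Proof.
apply/set0Pn; apply: contraTneq (comp3 v) => Nv.
rewrite -ltnNge ltnS (@leq_trans 1) // -(cards1 v).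
apply: subset_leq_card; apply/subsetP => u; rewrite !inE => /connectP[[|y p] /=].
  by move=> _ ->.
by case/andP => vy _ _; have := in_set0 y; rewrite -Nv inE vy.
Qed.

(** Two adjacent leaves would form a component of order 2. *)
Lemma leaf_neigh_not_leaf v u : neigh e v = [set u] -> #|neigh e u| != 1.
Proof.
move=> Nv; have vu : e v u by have := set11 u; rewrite -Nv inE.
apply: contraTneq (comp3 v) => /eqP/cards1P[y Nu].
have {}Nu : neigh e u = [set v].
  by rewrite Nu; congr [set _]; apply/esym/set1P; rewrite -Nu inE e_sym.
rewrite -ltnNge ltnS (@leq_trans #|[set v; u]|) //; last by rewrite cards2; case: (_ != _).
apply: subset_leq_card; apply/subsetP => x; rewrite inE => vx.
have closed_vu : closed e [in [set v; u]].
  apply: (intro_closed (sym_connect_sym e_sym)) => a b ab; rewrite !inE.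
  case/orP => /eqP ea; move: ab; rewrite {}ea => ab.
    by have : b \in neigh e v by [rewrite inE]; rewrite Nv inE => ->; rewrite orbT.
  by have : b \in neigh e u by [rewrite inE]; rewrite Nu inE => ->.
by rewrite -(closed_connect closed_vu vx) !inE eqxx.
Qed.

(* If [S :\ v] fails because of a fort [W] and [v] has at most one private neighbour, then [v] could *)
(* force unless it lies in [W] itself; hence any superset of [S :\ v] observing [v] succeeds.        *)
Lemma fort_private S v W : v \in S -> power_dominating e S -> fort e W ->
    [disjoint closed_neigh_set e (S :\ v) & W] -> #|private S v| <= 1 ->
  v \in W.
Proof.
move=> vS /power_dominatingP pd fW dis p1; have [w wW wS] := pd W fW.
apply: contraT => vW; have /andP[_ /forall_inP/(_ v)] := fW.
rewrite inE vW => /(_ isT); have sub : neigh e v :&: W \subset private S v.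
  by apply/subsetP => x; rewrite !inE => /andP[-> xW]; rewrite (disjointFl dis xW).
have := subset_leq_card sub; case E: #|neigh e v :&: W| => [|[|k]] //.
- move=> _ _; have NW0 := cards0_eq E; case/closed_neigh_setP: wS => u uS uw.
  have [uv|uv] := eqVneq u v.
    case/orP: uw => [/eqP wu|uw]; first by rewrite wu uv (negPf vW) in wW.
    by have := in_set0 w; rewrite -NW0 !inE -uv uw wW.
  suff : w \in closed_neigh_set e (S :\ v) by move/(disjointFr dis); rewrite wW.
  by apply/closed_neigh_setP; exists u; rewrite ?inE ?uv.
- by move=> le2; have := leq_trans le2 p1.
Qed.

Lemma power_dominating_swap S v u : v \in S -> power_dominating e S ->
  #|private S v| <= 1 -> e v u -> power_dominating e (u |: S :\ v).
Proof.
move=> vS pd p1 vu; apply/contraT => /power_dominatingPn[W fW dis].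
have subS : closed_neigh_set e (S :\ v) \subset closed_neigh_set e (u |: S :\ v).
  apply/subsetP => x /closed_neigh_setP[y yS xy]; apply/closed_neigh_setP.
  by exists y => //; rewrite in_setU1 yS orbT.
have vW := fort_private vS pd fW (disjointWl subS dis) p1.
rewrite -(disjointFl dis vW); apply/closed_neigh_setP; exists u.
  by rewrite !inE eqxx.
by rewrite e_sym vu orbT.
Qed.

Lemma card_swap S v u : v \in S -> u \notin S -> #|u |: S :\ v| = #|S|.
Proof.
by move=> vS uS; rewrite cardsU1 !inE (negPf uS) andbF add1n (cardsD1 v S) vS.
Qed.

(** Take a minimum set of least weight. If v has at most one private neighbour, minimality leaves v
    without neighbours in S, and v can be exchanged for any neighbour u; a suitable u lowers the
    weight. *)
Lemma private_ge2 : exists2 S, power_dominating e S &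
  #|S| = power_domination_number e /\ {in S, forall v, 1 < #|private S v|}.
Proof.
pose weight S := #|isolated_in S| + #|leaves_in S|.
pose minimum S := power_dominating e S && (#|S| == power_domination_number e).
have [S0 pd0 min0] := power_domination_number_witness e.
have mS0 : minimum S0 by rewrite /minimum pd0 min0 eqxx.
have [S /andP[pd /eqP cS] minS] := arg_minnP weight mS0.
exists S => //; split=> // v vS; rewrite ltnNge; apply/negP => p1.
have iso_v : neigh e v :&: S = set0.
  apply/eqP; apply: contraT => /set0Pn[s]; rewrite !inE => /andP[vs sS].
  suff : power_dominating e (S :\ v).
    by move/power_domination_number_le; rewrite -cS (cardsD1 v S) vS ltnn.
  apply/contraT => /power_dominatingPn[W fW dis].
  have vW := fort_private vS pd fW dis p1.
  rewrite -(disjointFl dis vW); apply/closed_neigh_setP; exists s.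
    by rewrite !inE sS andbT; apply: contraTneq vs => ->; rewrite e_irr.
  by rewrite e_sym vs orbT.
have notS u : e v u -> u \notin S.
  move=> vu; apply/negP => uS.
  by have := in_set0 u; rewrite -iso_v !inE vu uS.
have key u : e v u -> weight (u |: S :\ v) < weight S -> False.
  move=> vu; have := minS (u |: S :\ v); rewrite /minimum.
  by rewrite power_dominating_swap // card_swap ?notS // cS eqxx leqNgt => /(_ isT)/negP.
have v_iso : v \in isolated_in S by rewrite !inE vS iso_v eqxx.
have [sub|/subsetPn[u]] := boolP (neigh e v \subset private S v).
(* All neighbours of v are private, so v is a leaf. Its neighbour u is not a leaf and at worst
   replaces v as an isolated vertex: the number of leaves drops. *)
- have [u uN] := exists_neigh v.
  have Nv : neigh e v = [set u].
    by apply/eqP; rewrite eq_sym eqEcard sub1set uN cards1 (leq_trans (subset_leq_card sub)).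
  have vu : e v u by rewrite inE in uN.
  have [_ _ up] := privateP vS (subsetP sub u uN).
  apply: (key u vu); rewrite /weight -addnS leq_add //.
    rewrite (cardsD1 v (isolated_in S)) v_iso.
    apply: (@leq_trans #|u |: isolated_in S :\ v|); last by rewrite cardsU1 leq_add2r; case: (_ \notin _).
    apply: subset_leq_card; apply/subsetP => x; rewrite !inE.
    case: (eqVneq x u) => //= xu /andP[/andP[-> xS]] Nx; rewrite xS /=.
    apply/eqP/setP => y; rewrite !inE; apply/andP => -[xy yS].
    have [yv|yv] := eqVneq y v.
      have : x \in neigh e v by rewrite inE e_sym -yv.
      by rewrite Nv inE (negPf xu).
    by have := in_set0 y; rewrite -(eqP Nx) !inE xy yS yv orbT.
  have vl : v \in leaves_in S by rewrite !inE vS Nv cards1.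
  rewrite [X in _ < X](cardsD1 v) vl add1n ltnS; apply: subset_leq_card.
  apply/subsetP => x; rewrite !inE; case: (eqVneq x u) => [->|xu] /=.
    by rewrite (negPf (leaf_neigh_not_leaf Nv)).
  by case/andP=> /andP[-> ->] ->.
(* Now u is also adjacent to some other s in S, so u is neither isolated in the new set nor a leaf:
   the number of isolated vertices drops. *)
rewrite !inE => vu; rewrite vu andbT negbK => /closed_neigh_setP[s].
rewrite !inE => /andP[sv sS] /predU1P[us|su].
  by have := notS u vu; rewrite us sS.
apply: (key u vu); rewrite /weight -addSn leq_add //.
- rewrite (cardsD1 v (isolated_in S)) v_iso add1n ltnS; apply: subset_leq_card.
  apply/subsetP => x; rewrite !inE; case: (eqVneq x u) => [->|xu] /=.
    move=> /eqP Nu; have := in_set0 s.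
    by rewrite -Nu !inE e_sym su sS sv orbT.
  case/andP=> /andP[-> xS] Nx; rewrite xS /=.
  apply/eqP/setP => y; rewrite !inE; apply/andP => -[xy yS].
  have [yv|yv] := eqVneq y v.
    by have := notS x; rewrite e_sym -yv xy xS => /(_ isT).
  by have := in_set0 y; rewrite -(eqP Nx) !inE xy yS yv orbT.
- apply: subset_leq_card; apply/subsetP => x; rewrite !inE.
  case: (eqVneq x u) => [->|xu] /=; last by case/andP=> /andP[_ ->] ->.
  move=> /cards1P[y Nu]; have : v \in neigh e u by rewrite inE e_sym.
  have : s \in neigh e u by rewrite inE e_sym.
  by rewrite Nu !inE => /eqP sy /eqP vy; rewrite sy vy eqxx in sv.
Qed.

(** The sets [v |: private S v] for v in S are pairwise disjoint and have at least three elements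
    each. *)
Lemma power_domination_number_third : power_domination_number e <= #|T| %/ 3.
Proof.
have [S _ [<- S2]] := private_ge2; rewrite leq_divRL // -sum_nat_const.
apply: (@leq_trans (\sum_(v in S) \sum_(x in v |: private S v) 1)).
  apply: leq_sum => v vS; rewrite sum1_card cardsU1 !inE e_irr andbF add1n.
  by rewrite ltnS S2.
under eq_bigr do rewrite big_mkcond /=.
rewrite exchange_big -sum1_card /=; apply: leq_sum => x _.
rewrite -big_mkcondr /= sum1dep_card -ltnS ltnNge.
apply/negP => /card_gt1P[v [w []]].
rewrite !inE => /andP[vS /predU1P vx] /andP[wS /predU1P wx] /eqP; apply.
have inP u : (x \notin closed_neigh_set e (S :\ u)) && e u x -> x \in private S u.
  by rewrite !inE.
case: vx => [xv|vx]; case: wx => [xw|wx].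
- by rewrite -xv.
- have [_ + _] := privateP wS (inP _ wx); by rewrite xv vS.
- have [_ + _] := privateP vS (inP _ vx); by rewrite xw wS.
- have [vx' _ _] := privateP vS (inP _ vx); have [_ _ H] := privateP wS (inP _ wx).
  exact: H.
Qed.
End OneThird.

(** * Common neighbourhoods in a graph and its complement *)

Section CommonNeighbours.
Variable T : finType.
Implicit Types (r s : rel T) (J D Z : {set T}) (x y z : T).

Definition complementary r s :=
  [/\ symmetric r, irreflexive r & forall x y, s x y = (x != y) && ~~ r x y].

Definition common r J : {set T} := [set x | [forall y in J, r y x]].

Definition twins r x y : bool :=
  (x != y) && [forall z, (z != x) ==> (z != y) ==> (r z x == r z y)].

(** The twin clause records that a fort with exactly two elements is a pair of twins. *)
Definition rich r k := forall J, #|J| <= k -> 1 < #|common r J| /\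
  (#|common r J| = 2 -> {in common r J &, forall x y, x != y -> twins r x y}).

Definition at_least r j c := forall J, #|J| <= j -> c <= #|common r J|.

Lemma complementary_sym r s : complementary r s -> complementary s r.
Proof.
case=> rs ri rsE; split=> [x y|x|x y]; rewrite ?rsE ?eqxx 1?eq_sym 1?rs //.
by have [->|xy] := eqVneq x y; rewrite ?ri ?eqxx // negbK.
Qed.

Lemma commonP r J x : reflect {in J, forall y, r y x} (x \in common r J).
Proof. by rewrite inE; exact: forall_inP. Qed.

Lemma commonU1 r J x z : (z \in common r (x |: J)) = r x z && (z \in common r J).
Proof.
apply/commonP/andP => [H|[xz /commonP H] y].
  split; first by apply: H; rewrite setU11.
  by apply/commonP => y yJ; apply: H; rewrite setU1r.
by case/setU1P => [->|/H].
Qed.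

Lemma common1 r x z : (z \in common r [set x]) = r x z.
Proof.
by apply/commonP/idP => [->|xz y /set1P ->] //; rewrite set11.
Qed.

Lemma common2 r x y z : (z \in common r [set x; y]) = r x z && r y z.
Proof. by rewrite commonU1 common1. Qed.

Lemma commonS r J D : J \subset D -> common r D \subset common r J.
Proof.
move=> sub; apply/subsetP => x /commonP H; apply/commonP => y /(subsetP sub).
exact: H.
Qed.

Lemma twins_sym r x y : twins r x y = twins r y x.
Proof.
rewrite /twins eq_sym; congr (_ && _); apply: eq_forallb => z.
by rewrite [r z y == _]eq_sym; case: (z != x); case: (z != y).
Qed.

Lemma twinsE r x y z : twins r x y -> z != x -> z != y -> r z x = r z y.
Proof. by case/andP => _ /forallP/(_ z) + zx zy; rewrite zx zy => /eqP. Qed.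

Lemma twins_neq r x y : twins r x y -> x != y.
Proof. by case/andP. Qed.

Lemma complementary_twins r s x y : complementary r s -> twins s x y = twins r x y.
Proof.
case=> _ _ E; rewrite /twins; congr (_ && _); apply: eq_forallb => z; rewrite !E.
by case: (z != x); case: (z != y) => //=; case: (r z x); case: (r z y).
Qed.

Lemma twins_trans r : symmetric r -> forall x y z,
  twins r x y -> twins r y z -> x != z -> twins r x z.
Proof.
move=> rsym x y z xy yz xz; rewrite /twins xz; apply/forallP => u.
apply/implyP => ux; apply/implyP => uz; apply/eqP.
have [uy|uy] := eqVneq u y; last by rewrite (twinsE xy) // (twinsE yz).
rewrite uy rsym (twinsE yz) ?(twins_neq xy) // rsym.
by rewrite (twinsE xy) 1?eq_sym ?(twins_neq yz) // rsym.
Qed.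

Lemma at_least_le r j c d : c <= d -> at_least r j d -> at_least r j c.
Proof. by move=> cd H J Jj; apply: leq_trans cd (H J Jj). Qed.

Lemma rich_at_least r k : rich r k -> at_least r k 2.
Proof. by move=> H J /H[]. Qed.

Lemma card_subset_sub D k : k <= #|D| -> exists2 E : {set T}, E \subset D & #|E| = k.
Proof.
rewrite -bin_gt0 -cards_draws card_gt0 => /set0Pn[E].
by rewrite inE => /andP[ED /eqP Ek]; exists E.
Qed.

Lemma complementary_conflict r s x y : complementary r s -> s x y -> r x y = false.
Proof. by case=> _ _ ->; case/andP => _ /negPf. Qed.

(** Choose D of size b inside Z and a common [s]-neighbour x of D: the at least c common neighbours
    of [x |: J] lie in Z outside D. If Z had fewer than b elements, D would be all of Z, against
    [0 < c]. *)
Lemma common_grow r s (rs : complementary r s) j b c : 0 < c ->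
  at_least r j.+1 c -> at_least s b 1 -> at_least r j (c + b).
Proof.
move=> c0 Hr Hs J Jj; set Z := common r J.
have [D DZ Dk] := card_subset_sub (geq_minr b #|Z|).
have /Hs : #|D| <= b by rewrite Dk geq_minl.
rewrite card_gt0 => /set0Pn[x /commonP xD].
have cle : c <= #|common r (x |: J)| by apply: Hr; rewrite cardsU1; case: (_ \notin _); lia.
have sub : common r (x |: J) \subset Z :\: D.
  apply/subsetP => z; rewrite commonU1 in_setD => /andP[xz ->]; rewrite andbT.
  apply: contraTN xz => /xD zx; have [rsym _ _] := rs.
  by rewrite rsym (complementary_conflict rs zx).
have := subset_leq_card sub; rewrite cardsD (setIidPr DZ) Dk => le.
have := leq_trans cle le; rewrite /minn; case: ifP; lia.
Qed.

Lemma at_least_linear r s (rs : complementary r s) a b j : j <= a ->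
  at_least r a 2 -> at_least s b 2 -> at_least r j (2 + (a - j) * b).
Proof.
move=> ja Hr Hs; rewrite -{1}(subKn ja); elim: (a - j) (leq_subr j a) => [|k IHk] ka.
  by rewrite mul0n addn0 subn0.
rewrite mulSnr addnA; apply: (common_grow rs) => //.
  have := IHk (ltnW ka); by have -> : a - k = (a - k.+1).+1 by lia.
exact: at_least_le Hs.
Qed.

(** Removing any two elements of Z leaves room for a common neighbourhood of size at least 2, so Z
    has at least four elements. With exactly four, the complement of each pair is a pair of twins,
    so all of Z are twins; but some x is [s]-adjacent to two of them and [r]-adjacent to another. *)
Lemma at_least_twins_five r s (rs : complementary r s) k :
  rich r k.+1 -> rich s 2 -> at_least r k 5.
Proof.
move=> Hr Hs J Jk; set Z := common r J; have [rsym rirr rsE] := rs.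
have miss z1 z2 : z1 \in Z -> z2 \in Z -> exists2 x, common r (x |: J) \subset Z :\: [set z1; z2]
    & s z1 x && s z2 x.
  move=> z1Z z2Z; have [|+ _] := Hs [set z1; z2]; first by rewrite cards2; case: (_ != _).
  move=> /ltnW; rewrite card_gt0 => /set0Pn[x]; rewrite common2 => /andP[x1 x2].
  exists x; last by rewrite x1.
  apply/subsetP => z; rewrite commonU1 in_setD => /andP[xz ->]; rewrite andbT.
  by apply: contraTN xz => /set2P[] ->; rewrite rsym (complementary_conflict rs).
have two x : 1 < #|common r (x |: J)| /\ (#|common r (x |: J)| = 2 ->
     {in common r (x |: J) &, forall y z, y != z -> twins r y z}).
  by apply: Hr; rewrite cardsU1; case: (_ \notin _); lia.
have four z1 z2 : z1 \in Z -> z2 \in Z -> z1 != z2 -> 4 <= #|Z|.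
  move=> z1Z z2Z z12; have [x sub _] := miss _ _ z1Z z2Z.
  have := leq_trans (two x).1 (subset_leq_card sub); rewrite cardsD.
  rewrite (setIidPr _) ?cards2 ?z12; first by lia.
  by apply/subsetP => z /set2P[] ->.
have Z4 : 4 <= #|Z|.
  have [+ _] := Hr J (leqW Jk); rewrite -/Z => /card_gt1P[z1 [z2 [z1Z z2Z]]].
  exact: four.
rewrite ltnNge; apply/negP => Z4'; have {Z4 Z4'}Z4 : #|Z| = 4 by lia.
have rest z1 z2 : z1 \in Z -> z2 \in Z -> z1 != z2 ->
    {in Z :\: [set z1; z2] &, forall y z, y != z -> twins r y z}.
  move=> z1Z z2Z z12; have [x sub _] := miss _ _ z1Z z2Z.
  have [gt1 tw] := two x.
  have cZ : #|Z :\: [set z1; z2]| = 2.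
    rewrite cardsD (setIidPr _) ?cards2 ?z12 ?Z4 //.
    by apply/subsetP => z /set2P[] ->.
  have eqZ : common r (x |: J) = Z :\: [set z1; z2].
    by apply/eqP; rewrite eqEcard sub cZ.
  by rewrite -eqZ; apply: tw; rewrite eqZ.
have twZ : {in Z &, forall y z, y != z -> twins r y z}.
  move=> y z yZ zZ yz.
  have : 1 < #|Z :\: [set y; z]|.
    rewrite cardsD (setIidPr _) ?cards2 ?yz ?Z4 //.
    by apply/subsetP => u /set2P[] ->.
  move=> /card_gt1P[z1 [z2 []]]; rewrite !in_setD !in_set2 !negb_or.
  move=> /andP[/andP[z1y z1z] z1Z] /andP[/andP[z2y z2z] z2Z] z12.
  apply: (rest z1 z2) => //; rewrite in_setD in_set2 negb_or.
    by rewrite ![y == _]eq_sym z1y z2y.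
  by rewrite ![z == _]eq_sym z1z z2z.
have /card_gt1P[z1 [z2 [z1Z z2Z z12]]] : 1 < #|Z| by rewrite Z4.
have [x sub /andP[x1 x2]] := miss _ _ z1Z z2Z.
have /ltnW := (two x).1; rewrite card_gt0 => /set0Pn[z zx].
have := subsetP sub z zx; rewrite in_setD in_set2 negb_or => /andP[/andP[zz1 zz2] zZ].
move: zx; rewrite commonU1 => /andP[xz _].
have xz1 : x != z1 by have [_ sirr _] := complementary_sym rs; apply: contraTneq x1 => ->; rewrite sirr.
have xz' : x != z by apply: contraTneq xz => ->; rewrite rirr.
have := twinsE (twZ _ _ z1Z zZ _) xz1 xz'; rewrite eq_sym => /(_ zz1).
by rewrite xz rsym (complementary_conflict rs x1).
Qed.

(** Double count of the pairs (D, x) with D an i-subset of Z and x a common [s]-neighbour of D. A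
    vertex x outside J has at least c [r]-neighbours in Z, hence at most |Z| - c [s]-neighbours
    there, one fewer if x is itself in Z; vertices of J have none. *)
Lemma count_common r s (rs : complementary r s) J i c c' : 0 < i ->
  (forall x, x \notin J -> c <= #|common r (x |: J)|) ->
  (forall D, #|D| = i -> c' <= #|common s D|) ->
  c' * 'C(#|common r J|, i) <=
    (#|T| - #|J| - #|common r J|) * 'C(#|common r J| - c, i)
      + #|common r J| * 'C(#|common r J|.-1 - c, i).
Proof.
move=> i0 Hr Hs; set Z := common r J; have [rsym rirr rsE] := rs.
have [ssym sirr srE] := complementary_sym rs.
pose N x := [set y | s x y].
have step1 : c' * 'C(#|Z|, i) <= \sum_x 'C(#|Z :&: N x|, i).
  rewrite -cards_draws mulnC -sum_nat_const.
  apply: (@leq_trans (\sum_(D in [set A : {set T} | (A \subset Z) && (#|A| == i)])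
                         \sum_(x in common s D) 1)).
    by apply: leq_sum => D; rewrite inE sum1_card => /andP[_ /eqP]; exact: Hs.
  under eq_bigr do rewrite big_mkcond /=.
  rewrite exchange_big /=; apply: leq_sum => x _.
  rewrite -big_mkcondr /= sum1dep_card -cards_draws; apply: subset_leq_card.
  apply/subsetP => D; rewrite in_set => /andP[+ /commonP xD].
  rewrite !in_set => /andP[DZ ->]; rewrite andbT subsetI DZ; apply/subsetP => y yD.
  by rewrite inE ssym xD.
apply: leq_trans step1 _.
have JZ : [disjoint J & Z].
  apply/pred0P => x /=; apply/andP => -[xJ /commonP/(_ x xJ)]; by rewrite rirr.
rewrite (bigID (mem Z)) /= addnC; apply: leq_add; last first.
  rewrite -sum_nat_const; apply: leq_sum => x xZ; apply: leq_bin2l.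
  have := Hr x; rewrite (disjointFl JZ xZ) => /(_ isT).
  have sub : common r (x |: J) \subset Z :\ x :\: N x.
    apply/subsetP => z; rewrite commonU1 !in_setD in_set1 => /andP[xz ->].
    rewrite andbT inE rsE xz andbF /=; apply: contraTneq xz => ->; by rewrite rirr.
  have -> : Z :&: N x = (Z :\ x) :&: N x.
    apply/setP => y; rewrite !inE; case: eqP => [->|] //=; by rewrite sirr !andbF.
  have := subset_leq_card sub; rewrite cardsD.
  have := cardsD1 x Z; rewrite xZ.
  have := subset_leq_card (subsetIl (Z :\ x) (N x)); lia.
rewrite (bigID (mem J)) /= big1 ?add0n => [|x /andP[xZ xJ]]; last first.
  rewrite (_ : Z :&: N x = set0) ?cards0 ?bin0n; first by case: i i0 {Hs}.
  apply/setP => y; rewrite in_setI in_set0; apply/andP => -[/commonP/(_ x xJ) xy].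
  by rewrite inE rsE xy andbF.
have -> : #|T| - #|J| - #|Z| = #|~: (J :|: Z)|.
  rewrite [RHS]cardsCs setCK cardsU (eqP (_ : J :&: Z == set0)) ?setI_eq0 //.
  by rewrite cards0 subn0 subnDA.
rewrite -sum_nat_const (eq_bigl (mem (~: (J :|: Z)))); last first.
  by move=> x; rewrite /= in_setC in_setU negb_or andbC.
apply: leq_sum => x; rewrite /= in_setC in_setU negb_or => /andP[xJ xZ]; apply: leq_bin2l.
have sub : common r (x |: J) \subset Z :\: N x.
  apply/subsetP => z; rewrite commonU1 !in_setD => /andP[xz ->].
  by rewrite andbT inE rsE xz andbF.
have := Hr x xJ; have := subset_leq_card sub; rewrite cardsD.
have := subset_leq_card (subsetIl Z (N x)); lia.
Qed.

End CommonNeighbours.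

(** * Iterated lower bounds on the order *)

Section LowerBounds.
Variable T : finType.
Implicit Types (r s : rel T) (J D : {set T}).

(** The common [s]-neighbours of J are the vertices outside its closed [r]-neighbourhood, and these
    contain a fort. A fort is not a single vertex, since a neighbour of that vertex would see
    exactly one element; if it has two, every other vertex sees both or neither. *)
Lemma rich_of_power_domination r s k : complementary r s ->
  (forall v, exists u, u \in neigh r v) ->
  k < power_domination_number r -> rich s k.
Proof.
move=> rs nbr kpd J Jk; have [rsym rirr rsE] := rs.
have cE : common s J = ~: closed_neigh_set r J.
  apply/setP => x; rewrite in_setC; apply/commonP/idP => [H|+ y yJ].
    apply/closed_neigh_setP => -[v vJ]; have := H v vJ.
    by rewrite rsE eq_sym => /andP[/negPf -> /negPf ->].
  apply: contraR; rewrite rsE negb_and !negbK => H.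
  by apply/closed_neigh_setP; exists y => //; rewrite eq_sym.
have /power_dominatingPn[W fW dis] : ~~ power_dominating r J.
  by apply: contraL Jk => /power_domination_number_le; rewrite -ltnNge; apply: leq_trans.
have WJ : W \subset common s J.
  by rewrite cE -disjoints_subset disjoint_sym.
have /andP[W0 /forall_inP Wf] := fW.
have W2 : 1 < #|W|.
  rewrite ltnNge; apply/negP => W1.
  have /cards1P[w Ww] : #|W| == 1 by rewrite eqn_leq W1 card_gt0.
  have [u] := nbr w; rewrite inE => wu.
  have uW : u \in ~: W by rewrite Ww !inE; apply: contraTneq wu => ->; rewrite rirr.
  have := Wf u uW; rewrite Ww (setIidPr _) ?cards1 //.
  by rewrite sub1set inE rsym.
split=> [|c2 x y]; first exact: leq_trans (subset_leq_card WJ).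
have -> : common s J = W by apply/esym/eqP; rewrite eqEcard WJ c2.
move=> xW yW xy; rewrite (complementary_twins _ _ rs) /twins xy /=.
have {}c2 : #|W| = 2 by apply/eqP; rewrite eqn_leq W2 andbT -c2 subset_leq_card.
have Wxy : W = [set x; y].
  apply/esym/eqP; rewrite eqEcard c2 cards2 xy andbT.
  by apply/subsetP => z /set2P[] ->.
apply/forallP => z; apply/implyP => zx; apply/implyP => zy.
have := Wf z; rewrite in_setC Wxy in_set2 negb_or zx zy => /(_ isT).
apply: contraR => rzxy; case rzx : (r z x) rzxy; case rzy : (r z y) => // _.
  rewrite (_ : _ :&: _ = [set x]) ?cards1 //; apply/setP => u; rewrite !inE.
  case: (eqVneq u x) => [->|_] /=; rewrite ?rzx //.
  by case: eqP => [->|_]; rewrite ?rzy ?andbF.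
rewrite (_ : _ :&: _ = [set y]) ?cards1 //; apply/setP => u; rewrite !inE.
case: (eqVneq u y) => [->|_] /=; rewrite ?rzy ?orbT //.
by case: eqP => [->|_]; rewrite ?rzx ?andbF.
Qed.

Lemma common0 r : common r set0 = [set: T].
Proof. by apply/setP => x; rewrite in_setT; apply/commonP => y; rewrite inE. Qed.

Lemma commonT r s : complementary r s -> common r [set: T] = set0.
Proof.
case=> _ rirr _; apply/setP => x; rewrite in_set0; apply/commonP => /(_ x).
by rewrite inE rirr => /(_ isT).
Qed.

Lemma exists_superset J k : #|J| <= k <= #|T| -> exists2 D : {set T}, J \subset D & #|D| = k.
Proof.
move=> /andP[Jk kT].
have [|D DJ Dk] := @card_subset_sub T (~: J) (k - #|J|).
  by rewrite [#|~: J|]cardsCs setCK leq_sub2r.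
exists (J :|: D); first exact: subsetUl.
rewrite cardsU Dk (eqP (_ : J :&: D == set0)) ?cards0; first by lia.
by rewrite setI_eq0 disjoint_sym disjoints_subset.
Qed.

(* Binary arithmetic keeps the evaluation of [bound_chain] below cheap. *)
Fixpoint binary_ffact (z i : nat) : BinNums.N :=
  if i is i'.+1 then BinNat.N.mul (bin_of_nat z) (binary_ffact z.-1 i') else BinNums.Npos BinNums.xH.

Lemma nat_of_mul_bin (m n : BinNums.N) : BinNat.N.mul m n = m * n :> nat.
Proof. lia. Qed.

Lemma nat_of_add_bin (m n : BinNums.N) : BinNat.N.add m n = m + n :> nat.
Proof. lia. Qed.

Lemma leb_bin (m n : BinNums.N) : BinNat.N.leb m n = (m <= n)%N.
Proof. lia. Qed.

Lemma nat_of_binary_ffact z i : binary_ffact z i = z ^_ i :> nat.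
Proof. by elim: i z => [|i IHi] z //=; rewrite nat_of_mul_bin bin_of_natK IHi ffactnS. Qed.

(* [next_bound N a b j c] is the least size [z] of a common neighbourhood of [j] vertices that is  *)
(* compatible with [count_common], the bounds of [at_least_linear] on the complementary side, and  *)
(* the bound [c] for [j.+1] vertices; it is [N.+1] if there is none.                               *)
Definition feasible (N a b j c z : nat) : bool :=
  all (fun i => (b < i) || BinNat.N.leb
         (BinNat.N.mul (bin_of_nat (2 + (b - i) * a)) (binary_ffact z i))
         (BinNat.N.add (BinNat.N.mul (bin_of_nat (N - j - z)) (binary_ffact (z - c) i))
                       (BinNat.N.mul (bin_of_nat z) (binary_ffact (z.-1 - c) i))))
    [:: 1; 2; 3].

Definition next_bound N a b j c : nat :=
  c + find (fun d => feasible N a b j c (c + d)) (iota 0 (N.+1 - c)).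

Lemma feasibleP N a b j c z :
  (forall i, 0 < i <= b -> (2 + (b - i) * a) * 'C(z, i) <=
     (N - j - z) * 'C(z - c, i) + z * 'C(z.-1 - c, i)) ->
  feasible N a b j c z.
Proof.
move=> H; apply/allP => i i3; have [//|ib] := ltnP b i.
rewrite orFb leb_bin !(nat_of_add_bin, nat_of_mul_bin, nat_of_binary_ffact, bin_of_natK).
rewrite -!bin_ffact !mulnA -mulnDl leq_mul2r; apply/orP; right; apply: H.
by rewrite ib andbT; case: i i3 {ib}.
Qed.

(** The value at k is a lower bound for common neighbourhoods of a - k vertices. It starts from the
    2 in [rich]; the 5 at the next step is [at_least_twins_five]. *)
Fixpoint bound_chain N a b k : nat :=
  if k is k'.+1 then
    let c := bound_chain N a b k' in
    maxn (if k' == 0 then 5 else 0) (next_bound N a b (a - k) c)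
  else 2.

Lemma bound_chainP r s (rs : complementary r s) N a b k :
  2 <= b -> k <= a -> rich r a -> rich s b -> #|T| <= N ->
  at_least r (a - k) (bound_chain N a b k).
Proof.
move=> b2 + Hr Hs TN.
have ra := rich_at_least Hr; have sb := rich_at_least Hs.
(* The whole vertex set has no common neighbour. This inequality lets J be enlarged below to exactly
   j vertices. *)
have aT : a <= #|T|.
  rewrite leqNgt; apply/negP => Ta; have := ra [set: T].
  by rewrite cardsT (commonT rs) cards0 => /(_ (ltnW Ta)).
elim: k => [_|k IHk ka]; first by rewrite subn0.
set j := a - k.+1; have jk : a - k = j.+1 by rewrite /j; lia.
have {}IHk : at_least r j.+1 (bound_chain N a b k) by rewrite -jk; apply: IHk; exact: ltnW.
move=> J Jj; rewrite /= geq_max; apply/andP; split.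
  case: eqP => // k0; apply: (at_least_twins_five rs _ _ Jj).
    by rewrite (_ : j.+1 = a) // -jk k0 subn0.
  by move=> D D2; apply: Hs; apply: leq_trans b2.
set c := bound_chain N a b k in IHk *; rewrite -/j.
have [|D JD Dj] := @exists_superset J j; first by rewrite Jj /j; lia.
apply: leq_trans (subset_leq_card (commonS r JD)); set z := #|common r D|.
have cz : c <= z by apply: IHk; rewrite Dj.
have zN : z <= N by apply: leq_trans TN; exact: max_card.
rewrite /next_bound -leq_subRL // leqNgt; apply/negP => lt.
have := before_find 0 lt; rewrite nth_iota ?add0n ?subnKC //; last by lia.
move=> /negbT/negP; apply; apply: feasibleP => i /andP[i0 ib].
have Hc x : x \notin D -> c <= #|common r (x |: D)|.
  by move=> xD; apply: IHk; rewrite cardsU1 xD Dj.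
have Hc' (E : {set T}) : #|E| = i -> 2 + (b - i) * a <= #|common s E|.
  by move=> Ei; apply: (at_least_linear (complementary_sym rs) ib sb ra); rewrite Ei.
have := count_common rs i0 Hc Hc'; rewrite Dj -/z => /leq_trans -> //.
by rewrite leq_add2r leq_mul2r leq_sub2r ?leq_sub2r ?orbT.
Qed.

Lemma rich_bound_chain r s (rs : complementary r s) N a b :
  2 <= b -> rich r a -> rich s b -> N < bound_chain N a b a -> N < #|T|.
Proof.
move=> b2 Hr Hs; rewrite !ltnNge; apply: contra => TN.
have := bound_chainP rs b2 (leqnn a) Hr Hs TN (J := set0).
by rewrite cards0 common0 cardsT => /(_ isT)/leq_trans ->.
Qed.

(** The case i = 1 of [count_common] gives n c <= (n - d) z, so each vertex dropped from J gains a
    factor n / (n - d), which is at least p / q. The rational bound A / B avoids rounding losses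
    along the iteration. *)
Lemma geometric_growth r s (rs : complementary r s) j d p q A B :
  0 < B -> at_least s 1 d -> p * (#|T| - d) <= q * #|T| ->
  (forall J, #|J| <= j.+1 -> A <= B * #|common r J|) ->
  forall J, #|J| <= j -> p * A <= q * B * #|common r J|.
Proof.
move=> B0 Hd pq HA J Jj; set z := #|common r J|.
pose c := (A + B.-1) %/ B.
have cA : A <= B * c.
  have := ltn_ceil (A + B.-1) B0; rewrite -/c mulnC mulnS; lia.
have Hc : at_least r j.+1 c.
  move=> D /HA AD; rewrite -ltnS ltn_divLR // mulSn mulnC; lia.
have cz : c <= z by apply: Hc; exact: leqW.
have Hc1 x : x \notin J -> c <= #|common r (x |: J)|.
  by move=> xJ; apply: Hc; rewrite cardsU1 xJ.
have Hd1 (D : {set T}) : #|D| = 1 -> d <= #|common s D|.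
  by move=> D1; apply: Hd; rewrite D1.
have zT : z <= #|T| by exact: max_card.
have T0 : 0 < #|T| \/ z = 0 by lia.
have := count_common rs (isT : 0 < 1) Hc1 Hd1; rewrite -/z !bin1 => le.
have {}le : #|T| * c <= (#|T| - d) * z.
  have : d * z <= #|T| * (z - c).
    apply: leq_trans le _.
    rewrite -(@leq_pmul2r 1) // !muln1.
    apply: (@leq_trans ((#|T| - #|J| - z) * (z - c) + z * (z - c))).
      by rewrite leq_add2l leq_mul2l; lia.
    by rewrite -mulnDl leq_mul2r; lia.
  rewrite mulnBr mulnBl; have : #|T| * c <= #|T| * z by rewrite leq_mul2l cz orbT.
  lia.
case: T0 => [T0|z0]; last by have := cz; rewrite z0 leqn0 => /eqP c0; move: cA; rewrite c0 muln0; lia.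
rewrite -(leq_pmul2r T0).
apply: (@leq_trans (B * (p * (#|T| * c)))).
  apply: (@leq_trans (p * (B * c) * #|T|)).
    by rewrite leq_mul2r leq_mul2l cA !orbT.
  by rewrite (_ : p * (B * c) * #|T| = B * (p * (#|T| * c))) //; ring.
apply: (@leq_trans (B * (p * ((#|T| - d) * z)))).
  by rewrite !leq_mul2l le !orbT.
rewrite (_ : B * (p * _) = B * z * (p * (#|T| - d))); last by ring.
apply: (@leq_trans (B * z * (q * #|T|))); first by rewrite leq_mul2l pq orbT.
by rewrite (_ : _ * (q * _) = q * B * z * #|T|) //; ring.
Qed.

Lemma geometric_bound r s (rs : complementary r s) j d p q A :
  0 < q -> at_least s 1 d -> p * (#|T| - d) <= q * #|T| -> at_least r j A ->
  p ^ j * A <= q ^ j * #|T|.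
Proof.
move=> q0 Hd pq HA.
suff H k : k <= j -> forall J, #|J| <= j - k -> p ^ k * A <= q ^ k * #|common r J|.
  by have := H j (leqnn j) set0; rewrite cards0 common0 cardsT; exact.
elim: k => [_ J|k IHk kj J Jk]; first by rewrite subn0 !mul1n; exact: HA.
rewrite !expnS -mulnA; apply: (geometric_growth rs _ Hd pq _ Jk); first by rewrite expn_gt0 q0.
by have := IHk (ltnW kj); have -> : j - k = (j - k.+1).+1 by lia.
Qed.

End LowerBounds.

(** * Products other than 3 times 3 *)

(** Here [3 * uphalf (a.+1 * b.+1) - 1] is the largest n with a.+1 * b.+1 > 2 * (n / 3). The two
    lists cover b = 2 with a from 3 to 10, and 3 <= b <= a <= 6. *)
Lemma bound_chain_small :
  all (fun a => 3 * uphalf (a.+1 * 3) - 1 < bound_chain (3 * uphalf (a.+1 * 3) - 1) a 2 a)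
    (iota 3 8) &&
  all (fun a => all (fun b =>
      3 * uphalf (a.+1 * b.+1) - 1 < bound_chain (3 * uphalf (a.+1 * b.+1) - 1) a b a)
    (iota 3 (a - 2))) (iota 3 4).
Proof. by vm_compute. Qed.

(* With [n <= (3 a b + 1) / 2] the ratio in [geometric_bound] is 9/7 for [b = 3] and at least 49/33 *)
(* for larger [b].                                                                                  *)
Lemma exp_growth3 k : 9 <= k -> 7 ^ k * (9 * k + 28) < 12 * 9 ^ k.
Proof.
move=> k9; rewrite -(subnK k9); elim: (k - 9) => [|j IHj]; first by lia.
rewrite addSn !expnS; nia.
Qed.

Lemma exp_growth4 k : 5 <= k -> 33 ^ k * (3 * k + 10) <= 4 * 49 ^ k.
Proof.
move=> k5; rewrite -(subnK k5); elim: (k - 5) => [|j IHj]; first by lia.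
rewrite addSn !expnS; nia.
Qed.

Section Products.
Variable T : finType.
Implicit Types (r s : rel T).

(* Here [a.+1] and [b.+1] are the two power domination numbers. *)
Lemma rich_product r s a b : complementary r s ->
  3 <= a -> 2 <= b <= a -> rich r a -> rich s b ->
  a.+1 * b.+1 <= 2 * (#|T| %/ 3).
Proof.
move=> rs a3 /andP[b2 ba] Hr Hs; rewrite leqNgt; apply/negP => small.
have ra := rich_at_least Hr; have sb := rich_at_least Hs.
have T2 : 2 * #|T| <= 3 * (a.+1 * b.+1) + 1 by lia.
have /andP[/allP small3 /allP small4] := bound_chain_small.
have TN : #|T| <= 3 * uphalf (a.+1 * b.+1) - 1 by lia.
have chain : 3 * uphalf (a.+1 * b.+1) - 1 <
    bound_chain (3 * uphalf (a.+1 * b.+1) - 1) a b a -> False.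
  by move/(rich_bound_chain rs b2 Hr Hs); rewrite ltnNge TN.
have d1 : at_least s 1 (2 + (b - 1) * a).
  by apply: (at_least_linear (complementary_sym rs)) => //; lia.
have j2 : at_least r (a - 2) (2 + 2 * b).
  have := at_least_linear rs (leq_subr 2 a) ra sb.
  by rewrite subKn //; lia.
have [b3|b3] := ltnP 2 b.
- have [a7|a7] := leqP a 6.
    apply: chain; have := small4 a; rewrite mem_iota => /(_ _)/allP/(_ b).
    by rewrite mem_iota; apply; lia.
  have /(geometric_bound rs) : 49 * (#|T| - (2 + (b - 1) * a)) <= 33 * #|T|.
    have -> : b = (b - 3) + 3 by lia.
    have : 3 <= a by [].
    nia.
  move=> /(_ _ _ isT d1 j2).
  (* The contradiction comes from 2 n <= 3 (a + 1) (b + 1) + 1 < (3 a + 4) (b + 1). *)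
  have := @exp_growth4 (a - 2); have -> : 3 * (a - 2) + 10 = 3 * a + 4 by lia.
  move=> /(_ _)/wrap[]; first by lia.
  set x := 33 ^ _; set y := 49 ^ _; have : 0 < x by rewrite expn_gt0.
  nia.
have {b3}b2' : b = 2 by lia.
subst b.
have [a10|a10] := leqP a 10.
  by apply: chain; have := small3 a; rewrite mem_iota; apply; lia.
have /(geometric_bound rs) : 9 * (#|T| - (2 + (2 - 1) * a)) <= 7 * #|T| by lia.
move=> /(_ _ _ isT d1 j2).
have := @exp_growth3 (a - 2); have -> : 9 * (a - 2) + 28 = 9 * a + 10 by lia.
move=> /(_ _)/wrap[]; first by lia.
set x := 7 ^ _; set y := 9 ^ _; have : 0 < x by rewrite expn_gt0.
nia.
Qed.

End Products.

(** * Both power domination numbers equal to 3 *)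

(** The rank order splits the adjacent ordered pairs into two classes exchanged by reversal. *)
Lemma odd_handshake (T : finType) (r : rel T) (X : {set T}) :
  symmetric r -> irreflexive r -> ~~ odd (\sum_(x in X) #|neigh r x :&: X|).
Proof.
move=> rsym rirr.
pose half := \sum_(x in X) \sum_(y in X | r x y && (enum_rank x < enum_rank y)) 1.
suff -> : \sum_(x in X) #|neigh r x :&: X| = half + half by rewrite oddD addbb.
transitivity (half + \sum_(x in X) \sum_(y in X | r x y && (enum_rank y < enum_rank x)) 1).
  rewrite /half -big_split /=; apply: eq_bigr => x _; rewrite -sum1_card.
  rewrite (bigID (fun y => enum_rank x < enum_rank y)) /=; congr (_ + _).
    by apply: eq_bigl => y; rewrite !inE; case: (r x y); case: (y \in X).
  apply: eq_bigl => y; rewrite !inE; case rxy: (r x y); case: (y \in X) => //=.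
  rewrite -leqNgt leq_eqVlt; case: eqP => // /val_inj/enum_rank_inj xy.
  by rewrite xy rirr in rxy.
congr (_ + _); rewrite /half (exchange_big_dep (mem X)) /=; last by move=> x y _ /andP[].
apply: eq_bigr => x xX; apply: eq_bigl => y.
by rewrite rsym xX.
Qed.

Section Involution.
Variables (T : finType) (f : T -> T).
Hypothesis fK : involutive f.
(** A transversal of the two-element orbits of [f]; fixed points are left out. *)
Definition half_set := [set x | enum_rank x < enum_rank (f x)].

Lemma half_setP x : f x != x -> (f x \in half_set) = (x \notin half_set).
Proof.
move=> fx; rewrite !inE fK -leqNgt [RHS]leq_eqVlt; case: eqP => // /val_inj/enum_rank_inj.
by move/eqP; rewrite (negPf fx).
Qed.

Lemma card_half_set (W : {set T}) : {in W, forall x, f x \in W} -> {in W, forall x, f x != x} ->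
  #|W| = (#|W :&: half_set|).*2.
Proof.
move=> fW nfix; rewrite -addnn -(cardsID half_set W); congr (_ + _).
rewrite -(card_imset (W :&: half_set) (can_inj fK)); apply: eq_card => x.
rewrite in_setD; apply/andP/imsetP => [[xh xW]|[y]].
  exists (f x); rewrite ?fK // in_setI fW //=.
  by rewrite half_setP ?nfix.
rewrite in_setI => /andP[yW yh] ->; split; last exact: fW.
by rewrite half_setP ?nfix // negbK.
Qed.
End Involution.

Section ThreeThree.
Variable T : finType.
Implicit Types (r s : rel T) (t u v w x y z : T).
Hypothesis T14 : #|T| <= 14.

Local Notation deg r v := #|common r [set v]|.

Lemma avoid_twins r s x d z : complementary r s -> s d x -> (z == d) || twins r d z -> r x z = false.
Proof.
move=> rs dx; have [rsym rirr _] := rs; have [_ sirr _] := complementary_sym rs.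
have dx' : r x d = false by rewrite rsym (complementary_conflict rs).
case/predU1P => [->|tw] //; apply: contraFF dx' => xz.
rewrite (twinsE tw) //; first by apply: contraTneq dx => ->; rewrite sirr.
by apply: contraTneq xz => ->; rewrite rirr.
Qed.

Lemma deg_sum r s v : complementary r s -> (deg r v + deg s v).+1 = #|T|.
Proof.
move=> rs; have [_ rirr rsE] := rs; rewrite -cardsT (cardsD1 v [set: T]) in_setT add1n.
congr _.+1; rewrite -cardsUI (eqP (_ : _ :&: _ == set0)) ?cards0 ?addn0.
  apply: eq_card => x; rewrite in_setU !common1 rsE !inE andbT eq_sym.
  by case: eqP => [->|] /=; rewrite ?rirr //; case: (r v x).
apply/eqP/setP => x; rewrite in_setI !common1 rsE in_set0.
by case: (r v x); rewrite ?andbF.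
Qed.

Lemma rich2 r x v : rich r 2 -> 1 < #|common r [set x; v]| /\
  (#|common r [set x; v]| <= 2 -> {in common r [set x; v] &, forall y z, y != z -> twins r y z}).
Proof.
move=> Hr; have [|H1 H2] := Hr [set x; v]; first by rewrite cards2; case: (_ != _).
by split=> // H; apply: H2; apply/eqP; rewrite eqn_leq H.
Qed.

(** Without twins in Y, every x shares at least three neighbours with v, since two would have to be
    twins; counting pairs in Y then fails. *)
Lemma twins_in_common r s v : complementary r s -> rich r 2 -> rich s 2 ->
  deg r v <= 6 -> exists t u, [/\ t \in common r [set v], u \in common r [set v] & twins r t u].
Proof.
move=> rs Hr Hs Y6; set Y := common r [set v].
have Y5 : 4 < #|Y| by apply: (at_least_twins_five rs (k := 1)); rewrite ?cards1.
have [/exists_inP[t tY /exists_inP[u uY tw]]|no] := boolP [exists t in Y, [exists u in Y, twins r t u]].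
  by exists t, u.
have three x : x \notin [set v] -> 3 <= #|common r (x |: [set v])|.
  move=> _; have [c2 tw] := rich2 x v Hr; rewrite ltnNge; apply: contra no => /tw {}tw.
  have /card_gt1P[t [u [tA uA tu]]] := c2.
  apply/exists_inP; exists t; first by move: tA; rewrite commonU1 => /andP[].
  apply/exists_inP; exists u; first by move: uA; rewrite commonU1 => /andP[].
  exact: tw.
have two (D : {set T}) : #|D| = 2 -> 2 <= #|common s D|.
  by move=> D2; have [|] := Hs D; rewrite ?D2.
have := count_common rs (isT : 0 < 2) three two; rewrite cards1 -/Y.
(* For n at most 14 the count would give 20 <= 8 when |Y| = 5, and 30 <= 27 when |Y| = 6. *)
have /orP[/eqP -> | /eqP ->] : (#|Y| == 5) || (#|Y| == 6) by rewrite -/Y in Y6; lia.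
  by rewrite (_ : 'C(5, 2) = 10) // (_ : 'C(5 - 3, 2) = 1) // (_ : 'C(5.-1 - 3, 2) = 0) //; lia.
by rewrite (_ : 'C(6, 2) = 15) // (_ : 'C(6 - 3, 2) = 3) // (_ : 'C(6.-1 - 3, 2) = 1) //; lia.
Qed.

Lemma common_miss r s v t u z x : complementary r s -> twins r t u ->
  x \in common s [set t; z] ->
  common r [set x; v] \subset common r [set v] :\ t :\ u :\ z.
Proof.
move=> rs tw; rewrite common2 => /andP[tx zx]; apply/subsetP => y.
rewrite commonU1 => /andP[xy vy]; rewrite 3!in_setD1 vy andbT.
apply/and3P; split; apply: contraTneq xy => ->.
- by rewrite (avoid_twins rs zx) ?eqxx.
- by rewrite (avoid_twins rs tx) // tw orbT.
- by rewrite (avoid_twins rs tx) ?eqxx.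
Qed.

Lemma cardsD3 (A : {set T}) t u z : t \in A -> u \in A -> t != u ->
  #|A :\ t :\ u| = #|A| - 2 /\ (z \in A :\ t :\ u -> #|A :\ t :\ u :\ z| = #|A| - 3).
Proof.
move=> tA uA tu; have := cardsD1 t A; rewrite tA => e1.
have := cardsD1 u (A :\ t); rewrite in_setD1 eq_sym tu uA => e2.
split=> [|zA]; first by lia.
by have := cardsD1 z (A :\ t :\ u); rewrite zA; lia.
Qed.

(** If |Y| = 5, set aside twins t, u. For each of the three remaining z, a common [s]-neighbour x of
    t and z sees in Y exactly the other two, which are therefore twins. So all three are twins,
    while x separates z from the others. *)
Lemma deg_gt5 r s v : complementary r s -> rich r 2 -> rich s 2 -> 5 < deg r v.
Proof.
move=> rs Hr Hs; set Y := common r [set v].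
have Y5 : 4 < #|Y| by apply: (at_least_twins_five rs (k := 1)); rewrite ?cards1.
rewrite ltnNge; apply/negP => Y5'; have {Y5 Y5'}Y5 : #|Y| = 5 by lia.
have [|t [u [tY uY tw]]] := @twins_in_common r s v rs Hr Hs; first by rewrite -/Y Y5.
have tu := twins_neq tw; set R := Y :\ t :\ u.
have R3 : #|R| = 3 by have [-> _] := cardsD3 t tY uY tu; rewrite Y5.
have key z : z \in R -> exists2 x, s z x &
    common r [set x; v] = R :\ z /\ {in R :\ z &, forall y1 y2, y1 != y2 -> twins r y1 y2}.
  move=> zR; have [/ltnW + _] := rich2 t z Hs; rewrite card_gt0 => /set0Pn[x xC].
  exists x; first by move: xC; rewrite common2 => /andP[].
  have sub := common_miss v rs tw xC; have [A2 twA] := rich2 x v Hr.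
  have Rz : #|R :\ z| = 2 by have [_ ->] := cardsD3 z tY uY tu; rewrite ?Y5.
  have eqA : common r [set x; v] = R :\ z by apply/eqP; rewrite eqEcard sub Rz.
  by split=> //; rewrite -eqA; apply: twA; rewrite eqA Rz.
have /card_gt0P[z zR] : 0 < #|R| by rewrite R3.
have [_ _ [_ tw1]] := key z zR.
have Rz : #|R :\ z| = 2 by have := cardsD1 z R; rewrite zR R3; lia.
have /card_gt1P[z1 [z2 [z1R z2R z12]]] : 1 < #|R :\ z| by rewrite Rz.
have z1R' : z1 \in R by have := z1R; rewrite in_setD1 => /andP[].
have [x z1x [eqA _]] := key z1 z1R'.
have : z2 \in common r [set x; v].
  by rewrite eqA in_setD1 eq_sym z12; have := z2R; rewrite in_setD1 => /andP[].
by rewrite commonU1 (avoid_twins rs z1x) // tw1 ?orbT.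
Qed.

(** Each of the four z in R shares at least two [s]-neighbours with t. If no x served two of them, t
    would have [s]-degree at least 8, making n at least 15; an x serving two leaves only the other
    two elements of R, which must be twins. *)
Lemma six_second_twins r s v t u : complementary r s -> rich r 2 -> rich s 2 ->
  deg r v = 6 -> t \in common r [set v] -> u \in common r [set v] -> twins r t u ->
  exists p q, [/\ p \in common r [set v] :\ t :\ u, q \in common r [set v] :\ t :\ u & twins r p q].
Proof.
move=> rs Hr Hs; set Y := common r [set v] => Y6 tY uY tw; have tu := twins_neq tw.
set R := Y :\ t :\ u.
have R4 : #|R| = 4 by have [-> _] := cardsD3 t tY uY tu; rewrite Y6.
have [/exists_inP[p pR /exists_inP[q qR pq]]|no] := boolP [exists p in R, [exists q in R, twins r p q]].
  by exists p, q.
suff : 8 <= deg s t.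
  by have := deg_sum t rs; have := deg_gt5 t rs Hr Hs; lia.
apply: (@leq_trans (\sum_(z in R) \sum_(x in common s [set t; z]) 1)).
  rewrite (_ : 8 = \sum_(z in R) 2); last by rewrite sum_nat_const R4.
  by apply: leq_sum => z _; rewrite sum1_card; have [] := rich2 t z Hs.
under eq_bigr do rewrite big_mkcond /=.
rewrite exchange_big -sum1_card [X in _ <= X]big_mkcond /=; apply: leq_sum => x _.
rewrite common1 -big_mkcondr /=; case: ifPn => [tx|ntx]; last first.
  by rewrite big1 // => z /andP[_]; rewrite common2 (negPf ntx).
rewrite sum1dep_card leqNgt; apply: contra no => /card_gt1P[z1 [z2 []]].
rewrite [z1 \in _]inE [z2 \in _]inE => /andP[z1R z1x] /andP[z2R z2x] z12.
have [A2 twA] := rich2 x v Hr.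
have sub : common r [set x; v] \subset R :\ z1 :\ z2.
  rewrite subsetD1 (common_miss v rs tw z1x) /=.
  by have := common_miss v rs tw z2x; rewrite subsetD1 => /andP[].
have /twA {}twA : #|common r [set x; v]| <= 2.
  apply: leq_trans (subset_leq_card sub) _.
  by have [-> _] := cardsD3 z1 z1R z2R z12; rewrite R4.
have /card_gt1P[p [q [pA qA pq]]] := A2.
have subR : R :\ z1 :\ z2 \subset R by exact: subset_trans (subD1set _ _) (subD1set _ _).
apply/exists_inP; exists p; first exact: (subsetP subR) (subsetP sub p pA).
by apply/exists_inP; exists q; [exact: (subsetP subR) (subsetP sub q qA) | exact: twA].
Qed.

Lemma six_third_twins r s v t u p q : complementary r s -> rich r 2 -> rich s 2 ->
  deg r v = 6 -> t \in common r [set v] -> u \in common r [set v] -> twins r t u ->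
  p \in common r [set v] :\ t :\ u -> q \in common r [set v] :\ t :\ u -> twins r p q ->
  let R := common r [set v] :\ t :\ u :\ p :\ q in
  [/\ #|R| = 2, {in R &, forall y z, y != z -> twins r y z} & {in R, forall y, ~~ twins r t y}].
Proof.
move=> rs Hr Hs; set Y := common r [set v] => Y6 tY uY tw pR qR pq R.
have R2 : #|R| = 2.
  have [-> _] := cardsD3 p pR qR (twins_neq pq).
  by have [-> _] := cardsD3 t tY uY (twins_neq tw); rewrite Y6.
have [/ltnW + _] := rich2 t p Hs; rewrite card_gt0 => /set0Pn[x xC].
have /andP[tx px] : s t x && s p x by rewrite -common2.
have [A2 twA] := rich2 x v Hr.
have sub : common r [set x; v] \subset R.
  rewrite subsetD1 (common_miss v rs tw xC) /= commonU1.
  by rewrite (avoid_twins rs px) // pq orbT.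
have eqA : common r [set x; v] = R by apply/eqP; rewrite eqEcard sub R2.
split=> //; first by rewrite -eqA; apply: twA; rewrite eqA R2.
move=> y; rewrite -eqA commonU1 => /andP[xy _]; apply: contraTN xy => ty.
by rewrite (avoid_twins rs tx) // ty orbT.
Qed.

(** The neighbourhood of a vertex of degree 6 splits into three twin pairs, with no twins across
    pairs. *)
Lemma six_pairs r s v t : complementary r s -> rich r 2 -> rich s 2 ->
  deg r v = 6 -> t \in common r [set v] ->
  exists u, [/\ u \in common r [set v], twins r t u &
    {in common r [set v], forall w, twins r t w -> w = u}].
Proof.
move=> rs Hr Hs Y6; have Y6' : deg r v <= 6 by rewrite Y6.
have third := six_third_twins rs Hr Hs Y6.
have second := six_second_twins rs Hr Hs Y6.
have [t0 [u0 [t0Y u0Y tw0]]] := twins_in_common rs Hr Hs Y6'.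
set Y := common r [set v] in t0Y u0Y Y6 second third * => tY.
have [u [uY tu]] : exists u, u \in Y /\ twins r t u.
  have [->|tt0] := eqVneq t t0; first by exists u0.
  have [->|tu0] := eqVneq t u0; first by exists t0; rewrite twins_sym.
  have [p [q [pR qR pq]]] := second t0 u0 t0Y u0Y tw0.
  have RY := subset_trans (subD1set (Y :\ t0) u0) (subD1set Y t0).
  have [tp|tp] := eqVneq t p; first by exists q; rewrite tp (subsetP RY).
  have [tq|tq] := eqVneq t q; first by exists p; rewrite tq (subsetP RY) // twins_sym.
  have [R2 twR _] := third t0 u0 p q t0Y u0Y tw0 pR qR pq.
  have tR : t \in Y :\ t0 :\ u0 :\ p :\ q by rewrite !in_setD1 tt0 tu0 tp tq.
  have := cardsD1 t (Y :\ t0 :\ u0 :\ p :\ q); rewrite tR R2 => -[/esym/eqP/cards1P[y yE]].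
  have : y \in Y :\ t0 :\ u0 :\ p :\ q :\ t by rewrite yE set11.
  rewrite in_setD1 => /andP[yt yR]; exists y; split; last by apply: twR; rewrite // eq_sym.
  by move: yR; rewrite !in_setD1 => /and5P[].
exists u; split=> // w wY tw; apply/eqP; apply/negPn/negP => wu.
have [p [q [pR qR pq]]] := second t u tY uY tu.
have [R2 twR noR] := third t u p q tY uY tu pR qR pq.
have wt : w != t by rewrite eq_sym (twins_neq tw).
have /card_gt1P[y [z [yR zR yz]]] : 1 < #|Y :\ t :\ u :\ p :\ q| by rewrite R2.
have sub : {subset Y :\ t :\ u :\ p :\ q <= Y :\ t :\ u}.
  by move=> a; rewrite 2!in_setD1 => /and3P[].
(* Exchanging the second and third pairs also excludes p and q as twins of t. *)
have [_ _ noR'] := third t u y z tY uY tu (sub y yR) (sub z zR) (twR y z yR zR yz).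
have [wR|wR] := boolP (w \in Y :\ t :\ u :\ p :\ q).
  by have := noR w wR; rewrite tw.
suff wR' : w \in Y :\ t :\ u :\ y :\ z by have := noR' w wR'; rewrite tw.
move: wR; rewrite !in_setD1 wt wu wY !andbT => wR.
apply/andP; split; apply: contraNneq wR => ->.
  by have := zR; rewrite !in_setD1 => /and5P[-> ->].
by have := yR; rewrite !in_setD1 => /and5P[-> ->].
Qed.

Definition paired r t := exists u, twins r t u /\ forall w, twins r t w -> w = u.

(** Every twin of t is adjacent to v as well, so uniqueness inside the neighbourhood of v is
    uniqueness everywhere. *)
Lemma paired_of_neighbour r s v t : complementary r s -> rich r 2 -> rich s 2 ->
  deg r v = 6 -> r v t -> ~~ twins r t v -> paired r t.
Proof.
move=> rs Hr Hs d6 vt tv; have [rsym rirr _] := rs.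
have tY : t \in common r [set v] by rewrite common1.
have [u [uY tu uniq_u]] := six_pairs rs Hr Hs d6 tY.
exists u; split=> // w tw; apply: uniq_u => //; rewrite common1.
rewrite -(twinsE tw) //; first by apply: contraTneq vt => ->; rewrite rirr.
by apply: contraNneq tv => ->.
Qed.

Lemma pairedC r s t : complementary r s -> paired r t -> paired s t.
Proof.
move=> rs [u [tu uniq_u]]; exists u; rewrite (complementary_twins _ _ rs).
by split=> // w; rewrite (complementary_twins _ _ rs); exact: uniq_u.
Qed.

(* A vertex [t] is exceptional when it is not [paired]. *)
Lemma exceptional_neighbour r s t : complementary r s -> rich r 2 -> rich s 2 ->
  (forall v, deg r v = 6 \/ deg s v = 6) -> ~ paired r t ->
  (forall v, r v t -> ~~ twins r t v -> deg s v = 6) /\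
  (forall v, s v t -> ~~ twins r t v -> deg r v = 6).
Proof.
move=> rs Hr Hs d6 np; split=> v vt tv; case: (d6 v) => // dv; case: np.
  exact: (paired_of_neighbour rs Hr Hs dv vt).
apply: (pairedC (complementary_sym rs)).
apply: (paired_of_neighbour (complementary_sym rs) Hs Hr dv vt).
by rewrite (complementary_twins _ _ rs).
Qed.

Definition paired_inside r t z u :=
  [/\ r t z, r t u, twins r z u, r z u & forall w, twins r z w -> w = u].

(** The twin u of z comes from [six_pairs]. If it were [s]-adjacent to z, which has [s]-degree 6,
    then u would have a twin w among the [s]-neighbours of z; w is then another twin of z. *)
Lemma exceptional_neighbour_pair r s t z : complementary r s -> rich r 2 -> rich s 2 ->
  (forall v, deg r v = 6 \/ deg s v = 6) -> ~ paired r t -> deg r t = 6 ->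
  r t z -> ~~ twins r t z -> exists u, paired_inside r t z u.
Proof.
move=> rs Hr Hs d6 np dt tz ntz; have [rsym rirr rsE] := rs.
have sr := complementary_sym rs.
have zY : z \in common r [set t] by rewrite common1.
have [u [uY zu uniq_u]] := six_pairs rs Hr Hs dt zY.
have {}uniq_u w : twins r z w -> w = u.
  move=> zw; apply: uniq_u => //; rewrite common1 -(twinsE zw) //.
    by apply: contraTneq tz => ->; rewrite rirr.
  by apply: contraNneq ntz => ->; rewrite twins_sym.
exists u; split=> //; first by rewrite common1 in uY.
apply/negPn/negP => nzu; have szu : s z u by rewrite rsE (twins_neq zu).
have dz : deg s z = 6.
  by have [+ _] := exceptional_neighbour rs Hr Hs d6 np; apply; rewrite 1?rsym.
have uY' : u \in common s [set z] by rewrite common1.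
have [w [wY uw _]] := six_pairs sr Hs Hr dz uY'.
move: uw; rewrite (complementary_twins _ _ rs) => uw.
have zw : z != w by apply: contraTneq wY => ->; rewrite common1; case: sr => _ ->.
by have := twins_neq uw; rewrite (uniq_u w) ?eqxx // (twins_trans rsym zu uw).
Qed.

(** The common neighbours of x and t avoid both pairs, so they are exactly the two remaining
    neighbours of t. An x adjacent to t would be one of these two, hence adjacent to itself. *)
Lemma exceptional_miss r s t z1 u1 z2 u2 x : complementary r s -> rich r 2 ->
  deg r t = 6 -> paired_inside r t z1 u1 -> paired_inside r t z2 u2 ->
  z2 != z1 -> z2 != u1 -> x \in common s [set z1; z2] ->
  s t x /\ forall y, r t y -> y \notin [:: z1; u1; z2; u2] -> r x y.
Proof.
move=> rs Hr dt [tz1 tu1 tw1 r1 uniq1] [tz2 tu2 tw2 r2 uniq2] n1 n2 xC.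
have [rsym rirr rsE] := rs; have [ssym sirr _] := complementary_sym rs.
have n3 : u2 != z1.
  by apply: contraNneq n2 => e; apply/eqP/uniq1; rewrite twins_sym -e.
have n4 : u2 != u1.
  apply: contraNneq n2 => e; apply/eqP/uniq1; apply: (twins_trans rsym tw1).
    by rewrite twins_sym -e.
  by rewrite eq_sym.
have /andP[x1 x2] : s z1 x && s z2 x by rewrite -common2.
set Y := common r [set t] in dt *.
have memY z : (z \in Y) = r t z by rewrite common1.
have cR : #|Y :\ z1 :\ u1 :\ z2 :\ u2| = 2.
  have [|||-> _] := @cardsD3 (Y :\ z1 :\ u1) z2 u2 z1.
  - by rewrite !in_setD1 n1 n2 memY tz2.
  - by rewrite !in_setD1 n3 n4 memY tu2.
  - exact: (twins_neq tw2).
  have [|||-> _] := @cardsD3 Y z1 u1 z1; rewrite ?memY ?(twins_neq tw1) //.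
  by rewrite dt.
have sub : common r [set x; t] \subset Y :\ z1 :\ u1 :\ z2 :\ u2.
  apply/subsetP => y; rewrite commonU1 => /andP[xy yY]; rewrite !in_setD1 yY andbT.
  apply/and4P; split; apply: contraTneq xy => ->.
  - by rewrite (avoid_twins rs x2) // tw2 orbT.
  - by rewrite (avoid_twins rs x2) ?eqxx.
  - by rewrite (avoid_twins rs x1) // tw1 orbT.
  - by rewrite (avoid_twins rs x1) ?eqxx.
have [A2 _] := rich2 x t Hr.
have eqA : common r [set x; t] = Y :\ z1 :\ u1 :\ z2 :\ u2.
  by apply/eqP; rewrite eqEcard sub cR.
split=> [|y ty]; last first.
  rewrite !inE !negb_or => /and4P[y1 y2 y3 y4].
  have : y \in common r [set x; t] by rewrite eqA !in_setD1 y1 y2 y3 y4 memY.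
  by rewrite commonU1 => /andP[].
rewrite rsE; apply/andP; split.
  by apply: contraTneq x1 => <-; rewrite rsE rsym tz1 andbF.
apply/negP => tx; have : x \notin Y :\ z1 :\ u1 :\ z2 :\ u2.
  by rewrite -eqA commonU1 rirr.
rewrite !in_setD1 memY tx andbT => /negP; apply; apply/and4P; split.
- by apply: contraTneq x2 => ->; rewrite rsE r2 andbF.
- by apply: contraTneq x2 => ->; rewrite sirr.
- by apply: contraTneq x1 => ->; rewrite rsE r1 andbF.
- by apply: contraTneq x1 => ->; rewrite sirr.
Qed.

(** An unpaired t with a twin has two twins w, w'. The neighbours of t form three pairs; common
    [s]-neighbours of two representatives give three disjoint sets of at least two [s]-neighbours of
    t. Adding w and w' yields [s]-degree at least 8, so n is at least 15. *)
Lemma exceptional_no_twins r s t : complementary r s -> rich r 2 -> rich s 2 ->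
  (forall v, deg r v = 6 \/ deg s v = 6) -> ~ paired r t -> deg r t = 6 ->
  forall u, ~~ twins r t u.
Proof.
move=> rs Hr Hs d6 np dt; have [rsym rirr rsE] := rs.
set Y := common r [set t] in dt *.
have memY z : (z \in Y) = r t z by rewrite common1.
have pick_pair z := exceptional_neighbour_pair rs Hr Hs d6 np dt (z := z).
have miss z1 u1 z2 u2 x := @exceptional_miss r s t z1 u1 z2 u2 x rs Hr dt.
have card2 (A : {set T}) x y : #|A| - 2 <= #|A :\ x :\ y|.
  have := cardsD1 x A; have := cardsD1 y (A :\ x).
  by case: (y \in _); case: (x \in _); lia.
(* A twin u of t adjacent to t would be separated from t by the x of [exceptional_miss]. *)
have noY u : r t u -> ~~ twins r t u.
  move=> tu; apply/negP => tw.
  have uY : u \in Y by rewrite memY.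
  have [w [wY uw uniq_w]] := six_pairs rs Hr Hs dt uY.
  have other z : z \in Y :\ u :\ w -> r t z /\ ~~ twins r t z.
    rewrite !in_setD1 => /and3P[zw zu zY]; split; first by rewrite -memY.
    apply: contra zw => tz; apply/eqP; apply: uniq_w => //.
    by apply: (twins_trans rsym _ tz); rewrite 1?eq_sym // twins_sym.
  have /card_gt0P[z1 z1R] : 0 < #|Y :\ u :\ w| by have := card2 Y u w; lia.
  have [tz1 ntz1] := other z1 z1R; have [u1 p1] := pick_pair z1 tz1 ntz1.
  have /card_gt0P[z2] : 0 < #|Y :\ u :\ w :\ z1 :\ u1|.
    by have := card2 Y u w; have := card2 (Y :\ u :\ w) z1 u1; lia.
  rewrite 2!in_setD1 => /and3P[z2u1 z2z1 z2R].
  have [tz2 ntz2] := other z2 z2R; have [u2 p2] := pick_pair z2 tz2 ntz2.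
  have [/ltnW + _] := rich2 z1 z2 Hs; rewrite card_gt0 => /set0Pn[x xC].
  have [tx rxy] := miss z1 u1 z2 u2 x p1 p2 z2z1 z2u1 xC.
  have notR z v : paired_inside r t z v -> ~~ twins r t z -> (u != z) && (u != v).
    move=> [tz _ zv _ _] ntz; apply/andP; split; first by apply: contraNneq ntz => <-.
    apply: contraNneq ntz => e; apply: (twins_trans rsym tw); first by rewrite e twins_sym.
    by apply: contraTneq tz => <-; rewrite rirr.
  have xu : r x u.
    apply: rxy => //; rewrite !inE !negb_or.
    by have /andP[-> ->] := notR z1 u1 p1 ntz1; have /andP[-> ->] := notR z2 u2 p2 ntz2.
  have : r x t.
    rewrite (twinsE tw) //; first by apply: contraTneq tx => ->; rewrite rsE eqxx.
    by apply: contraTneq xu => ->; rewrite rirr.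
  by rewrite rsym (complementary_conflict rs tx).
move=> w; apply/negP => tw.
have [w' tw' ww'] : exists2 w', twins r t w' & w' != w.
  have [/exists_inP[w' tw' ww']|no] := boolP [exists w' in twins r t, w' != w].
    by exists w'.
  case: np; exists w; split=> // w' tw'; apply/eqP; apply: contraNT no => ww'.
  by apply/exists_inP; exists w'.
have pair z : z \in Y -> exists u, paired_inside r t z u.
  by rewrite memY => tz; apply: pick_pair => //; exact: noY.
have /card_gt0P[z1 z1Y] : 0 < #|Y| by rewrite dt.
have [u1 p1] := pair z1 z1Y.
have /card_gt0P[z2 z2R] : 0 < #|Y :\ z1 :\ u1| by have := card2 Y z1 u1; lia.
move: z2R; rewrite 2!in_setD1 => /and3P[z21' z21 z2Y].
have [u2 p2] := pair z2 z2Y.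
have /card_gt0P[z3 z3R] : 0 < #|Y :\ z1 :\ u1 :\ z2 :\ u2|.
  by have := card2 Y z1 u1; have := card2 (Y :\ z1 :\ u1) z2 u2; lia.
move: z3R; rewrite 4!in_setD1 => /and5P[z32' z32 z31' z31 z3Y].
have [u3 p3] := pair z3 z3Y.
have z23' : z2 != u3.
  apply: contraNneq z32' => e; apply/eqP; case: p2 => _ _ _ _; apply.
  by rewrite e twins_sym; case: p3.
pose B12 := common s [set z1; z2]; pose B13 := common s [set z1; z3].
pose B23 := common s [set z2; z3].
have m12 x : x \in B12 -> s t x /\ r x z3.
  move=> /(miss z1 u1 z2 u2 x p1 p2 z21 z21')[tx rx]; split=> //; apply: rx; rewrite -?memY //.
  by rewrite !inE !negb_or z31 z31' z32 z32'.
have m13 x : x \in B13 -> s t x /\ r x z2.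
  move=> /(miss z1 u1 z3 u3 x p1 p3 z31 z31')[tx rx]; split=> //; apply: rx; rewrite -?memY //.
  by rewrite !inE !negb_or z21 z21' [z2 == z3]eq_sym z32 z23'.
have m23 x : x \in B23 -> s t x by move=> /(miss z2 u2 z3 u3 x p2 p3 z32 z32')[].
have nrs x y : r x y -> s y x = false.
  move=> xy; have sr := complementary_sym rs; have [ssym _ _] := sr.
  by rewrite ssym (complementary_conflict sr xy).
have d1 : B12 :&: (B13 :|: B23) = set0.
  apply/setP => x; rewrite in_setI in_setU in_set0; apply/negP => /andP[/m12[_ /nrs xz3]].
  by rewrite !common2 xz3 !andbF.
have d2 : B13 :&: B23 = set0.
  apply/setP => x; rewrite in_setI in_set0; apply/negP => /andP[/m13[_ /nrs xz2]].
  by rewrite common2 xz2.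
have c6 : 6 <= #|B12 :|: (B13 :|: B23)|.
  rewrite !cardsU d1 d2 cards0 !subn0.
  have c12 : 1 < #|B12| by have [] := rich2 z1 z2 Hs.
  have c13 : 1 < #|B13| by have [] := rich2 z1 z3 Hs.
  have c23 : 1 < #|B23| by have [] := rich2 z2 z3 Hs.
  exact: leq_add c12 (leq_add c13 c23).
have adj v z : twins r t v -> r t z -> s z v = false.
  move=> tv tz; apply: nrs; rewrite rsym -(twinsE tv) 1?rsym //.
    by apply: contraTneq tz => ->; rewrite rirr.
  by apply: contraTneq tz => ->; apply: contraL tv; exact: noY.
have stv v : twins r t v -> s t v.
  move=> tv; rewrite rsE (twins_neq tv) /=; apply: contraL tv; exact: noY.
have d3 : [set w; w'] :&: (B12 :|: (B13 :|: B23)) = set0.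
  apply/setP => v; rewrite in_setI in_set0; apply/negP => /andP[vw].
  have tv : twins r t v by case/set2P: vw => ->.
  by rewrite !in_setU !common2 !(adj v) -?memY.
have sub : [set w; w'] :|: (B12 :|: (B13 :|: B23)) \subset common s [set t].
  apply/subsetP => v; rewrite common1 !in_setU.
  case/orP => [|/or3P[/m12[]|/m13[]|/m23]] //.
  by case/orP => /set1P ->; exact: stv.
have := subset_leq_card sub; rewrite cardsU d3 cards0 subn0 cards2 eq_sym ww' => le.
have : 14 < #|T|.
  by rewrite -(deg_sum t rs) -/Y dt ltnS (leq_add2l 6 8) (leq_trans (leq_add (leqnn 2) c6) le).
by rewrite ltnNge T14.
Qed.

Lemma paired_dec r t : paired r t \/ ~ paired r t.
Proof.
have [/existsP[u /andP[tu /forall_inP H]]|no] :=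
  boolP [exists u, twins r t u && [forall w in twins r t, w == u]].
  by left; exists u; split=> // w tw; apply/eqP/H.
right=> -[u [tu H]]; apply/negP: no; rewrite negbK; apply/existsP; exists u; rewrite tu.
by apply/forall_inP => w tw; apply/eqP/H.
Qed.

Definition twin_of r t := odflt t [pick u | twins r t u].

Lemma twin_ofP r t : paired r t -> twins r t (twin_of r t) /\ forall w, twins r t w -> w = twin_of r t.
Proof.
move=> [u [tu H]]; rewrite /twin_of; case: pickP => [w tw|/(_ u)]; last by rewrite tu.
by split=> // w'; rewrite [odflt _ _](H w tw) => /H.
Qed.

Lemma twin_of_fix r t : (forall u, ~~ twins r t u) -> twin_of r t = t.
Proof. by move=> H; rewrite /twin_of; case: pickP => // u; rewrite (negPf (H u)). Qed.

Lemma twin_ofK r : (forall t, paired r t \/ forall u, ~~ twins r t u) -> involutive (twin_of r).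
Proof.
move=> H t; have [/twin_ofP[tw _]|no] := H t; last by rewrite !twin_of_fix.
have [/twin_ofP[_ uniq]|no] := H (twin_of r t); first by apply/esym/uniq; rewrite twins_sym.
by have := no t; rewrite twins_sym tw.
Qed.

(** If t were unpaired, every other vertex would be paired, and the twin involution would match up
    the 13 vertices other than t. *)
Lemma paired_of_deg6 r s t : complementary r s -> rich r 2 -> rich s 2 -> #|T| = 14 ->
  deg r t = 6 -> paired r t.
Proof.
move=> rs Hr Hs T14' dt; have [//|np] := paired_dec r t.
have [rsym rirr rsE] := rs.
have sr := complementary_sym rs; have [ssym sirr srE] := sr.
have d6 v : deg r v = 6 \/ deg s v = 6.
  have := deg_sum v rs; have := deg_gt5 v rs Hr Hs; have := deg_gt5 v sr Hs Hr; lia.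
have notboth v : deg r v = 6 -> deg s v = 6 -> False.
  by have := deg_sum v rs; lia.
have nt := exceptional_no_twins rs Hr Hs d6 np dt.
have [Hrt Hst] := exceptional_neighbour rs Hr Hs d6 np.
have pv v : v != t -> paired r v.
  move=> vt; have [tv|ntv] := boolP (r t v).
    have [u [_ _ vu _ uniq_u]] := exceptional_neighbour_pair rs Hr Hs d6 np dt tv (nt v).
    by exists u.
  have [//|npv] := paired_dec r v.
  have svt : s v t by rewrite rsE vt rsym.
  have dv := Hst v svt (nt v).
  have nv := exceptional_no_twins rs Hr Hs d6 npv dv.
  have [Hrv _] := exceptional_neighbour rs Hr Hs d6 npv.
  (* A neighbour of v not adjacent to t would have degree 6 in both graphs, forcing n = 13. Equal
     neighbourhoods make v a twin of t, which has none. *)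
  have eqN : common r [set v] = common r [set t].
    apply/eqP; rewrite eqEcard dv dt andbT; apply/subsetP => w; rewrite !common1 => vw.
    have dw : deg s w = 6 by apply: Hrv; rewrite 1?rsym.
    apply/negPn/negP => ntw; apply: (notboth w) => //; apply: Hst => //.
    rewrite rsE rsym ntw andbT; apply: contraTneq vw => ->.
    by rewrite (complementary_conflict rs svt).
  have : ~~ twins r t v := nt v.
  rewrite /twins eq_sym vt => /forallPn[z]; rewrite !negb_imply => /and3P[_ _].
  by rewrite ![r z _]rsym -(common1 r t) -(common1 r v) eqN eqxx.
have fK : involutive (twin_of r).
  by apply: twin_ofK => v; have [->|/pv] := eqVneq v t; [right | left].
have := card_half_set fK (W := [set: T] :\ t) _ _.
have -> : #|[set: T] :\ t| = 13 by have := cardsD1 t [set: T]; rewrite in_setT cardsT T14' => -[].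
move=> H; suff : false by []; have /(congr1 odd) : 13 = #|([set: T] :\ t) :&: half_set (twin_of r)|.*2.
  apply: H => x; rewrite in_setD1 in_setT andbT => /pv/twin_ofP[tw _].
    by rewrite in_setD1 in_setT andbT; apply: contraTneq tw => ->; rewrite twins_sym.
  by rewrite eq_sym (twins_neq tw).
by rewrite odd_double.
Qed.

Lemma not_rich_three_three r s : complementary r s -> rich r 2 -> rich s 2 -> False.
Proof.
move=> rs Hr Hs; have [rsym rirr rsE] := rs; have sr := complementary_sym rs.
have degs v : [/\ 5 < deg r v, 5 < deg s v & (deg r v + deg s v).+1 = #|T|].
  by rewrite (deg_gt5 v rs Hr Hs) (deg_gt5 v sr Hs Hr) (deg_sum v rs).
have [t _] : exists t : T, t \in [set: T].
  have [|c2 _] := Hr set0; first by rewrite cards0.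
  by move: c2; rewrite common0 => /ltnW; rewrite card_gt0 => /set0Pn.
have pv v : paired r v.
  have [g1 g2 dv] := degs v.
  have [T13|T14'] : #|T| = 13 \/ #|T| = 14 by lia.
    have d6 w : deg r w = 6 by have [] := degs w; lia.
    have /card_gt1P[x [y [xY yY xy]]] : 1 < #|common r [set v]| by rewrite d6.
    have [u [uY xu uniq_u]] := six_pairs rs Hr Hs (d6 v) xY.
    have [w [wY vw]] : exists w, w \in common r [set v] /\ ~~ twins r v w.
      have [vx|] := boolP (twins r v x); last by exists x.
      have /card_gt0P[z zR] : 0 < #|common r [set v] :\ x :\ u|.
        by have [-> _] := cardsD3 v xY uY (twins_neq xu); rewrite d6.
      move: zR; rewrite 2!in_setD1 => /and3P[zu zx zY]; exists z; split=> //.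
      apply: contra zu => vz; apply/eqP/uniq_u => //.
      by apply: (twins_trans rsym _ vz); rewrite 1?eq_sym // twins_sym.
    rewrite common1 in wY.
    by apply: (paired_of_neighbour rs Hr Hs (d6 w)); rewrite 1?rsym.
  have [d6|d6] : deg r v = 6 \/ deg s v = 6 by lia.
    exact: (paired_of_deg6 rs).
  by apply: (pairedC sr); apply: (paired_of_deg6 sr).
have fK : involutive (twin_of r) by apply: twin_ofK => v; left.
have ftw v : twins r v (twin_of r v) by have [] := twin_ofP (pv v).
have funiq v w : twins r v w -> w = twin_of r v by have [_] := twin_ofP (pv v); apply.
have nfix v : twin_of r v != v by rewrite eq_sym (twins_neq (ftw v)).
set X := half_set (twin_of r).
have cT : #|T| = #|X|.*2.
  by rewrite -cardsT (card_half_set fK) ?setTI // => v _; rewrite ?inE.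
have {cT}[T14' X7] : #|T| = 14 /\ #|X| = 7 by have [] := degs t; lia.
(* A vertex is adjacent to its twin exactly when its degree is 7, so in either case it has six other
   neighbours, closed under taking twins. *)
have deg3 x : x \in X -> #|neigh r x :&: X| = 3.
  move=> xX; pose W := [set y | r x y && (y != twin_of r x)].
  have -> : neigh r x :&: X = W :&: X.
    apply/setP => y; rewrite 2!in_setI; case yX: (y \in X); rewrite ?andbF // !andbT !inE.
    suff -> : y != twin_of r x by rewrite andbT.
    by apply: contraTneq yX => ->; rewrite half_setP // xX.
  suff W6 : #|W| = 6.
    have := card_half_set fK (W := W) _ _; rewrite W6 -/X => H.
    suff : 6 = #|W :&: X|.*2 by lia.
    apply: H => [y|y _]; last exact: nfix.
    rewrite !inE => /andP[xy yfx]; rewrite -(twinsE (ftw y)) ?xy /=.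
    - by apply: contraTneq xy => /(can_inj fK) ->; rewrite rirr.
    - by apply: contraTneq xy => ->; rewrite rirr.
    - by apply: contraNneq yfx => ->; rewrite fK.
  have [d6|d6] : deg r x = 6 \/ deg s x = 6 by have [] := degs x; lia.
    have xfx : ~~ r x (twin_of r x).
      apply/negP => xfx; have fY : twin_of r x \in common r [set x] by rewrite common1.
      have [u [uY fu _]] := six_pairs rs Hr Hs d6 fY.
      by have := uY; rewrite common1 (funiq _ _ fu) fK rirr.
    rewrite -d6; apply: eq_card => y; rewrite common1 inE.
    by case: eqP => [->|]; rewrite ?andbT // (negPf xfx).
  have xfx : r x (twin_of r x).
    apply/negPn/negP => xfx; have fY : twin_of r x \in common s [set x].
      by rewrite common1 rsE xfx eq_sym nfix.
    have [u [uY fu _]] := six_pairs sr Hs Hr d6 fY.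
    rewrite (complementary_twins _ _ rs) in fu.
    by have := uY; rewrite common1 (funiq _ _ fu) fK; case: sr => _ ->.
  have := cardsD1 (twin_of r x) (common r [set x]); rewrite common1 xfx.
  have -> : common r [set x] :\ twin_of r x = W.
    by apply/setP => y; rewrite in_setD1 common1 inE andbC.
  by have [] := degs x; lia.
have := odd_handshake X rsym rirr.
by rewrite (eq_bigr (fun=> 3)) // sum_nat_const X7.
Qed.

End ThreeThree.

(** * Assembling the cases *)

Lemma power_domination_product_le (T : finType) (r s : rel T) : complementary r s ->
  (forall v, 3 <= #|component r v|) -> (forall v, 3 <= #|component s v|) ->
  power_domination_number s <= power_domination_number r ->
  power_domination_number r * power_domination_number s <= 2 * (#|T| %/ 3).
Proof.
move=> rs r3 s3 sr_le; have sr := complementary_sym rs.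
have [rsym rirr _] := rs; have [ssym sirr _] := sr.
have := power_domination_number_third rsym rirr r3.
have rich_s := rich_of_power_domination rs (exists_neigh r3).
have rich_r := rich_of_power_domination sr (exists_neigh s3).
case: (power_domination_number r) (power_domination_number s) sr_le rich_s rich_r.
  by move=> b _ _ _ _; rewrite mul0n.
move=> a [|b] ba Hs Hr third; first by rewrite muln0.
(* From here [a.+1] and [b.+1] are the two numbers, the latter being the smaller; if it is at most
   2, the bound n / 3 on the other suffices. *)
have [b1|b1] := leqP b 1; first by rewrite mulnC leq_mul.
have [a2|a2] := leqP a 2; last first.
  apply: (rich_product sr) => //; [by rewrite b1 | exact: Hs | exact: Hr].
have ea : a = 2 by lia.
have eb : b = 2 by lia.
rewrite ea eb in Hs Hr *; rewrite leqNgt; apply/negP => small.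
have T14 : #|T| <= 14 by lia.
exact: (not_rich_three_three T14 rs (Hr 2 isT) (Hs 2 isT)).
Qed.

Theorem power_domination_product (T : finType) (e : rel T) :
  symmetric e -> irreflexive e ->
  (forall v, 3 <= #|component e v|) -> (forall v, 3 <= #|component (compl_graph e) v|) ->
  power_domination_number e * power_domination_number (compl_graph e) <= 2 * (#|T| %/ 3).
Proof.
move=> e_sym e_irr comp_G comp_Gc.
have ec : complementary e (compl_graph e) by [].
have [le|lt] := leqP (power_domination_number (compl_graph e)) (power_domination_number e).
  exact: power_domination_product_le.
by rewrite mulnC; apply: (power_domination_product_le (complementary_sym ec)) => //; exact: ltnW.
Qed.

From mathcomp Require Import all_boot all_order all_algebra.
From mathcomp Require Import boolp classical_sets reals topology normedtype.

Theorem corollary4p4 (R : realType) (n : nat) (T : finType) (e : rel T)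
    (e_sym : symmetric e) (e_irr : irreflexive e)
    (T_nonempty : 0 < #|T|) (order_n : #|T| = n)
    (comp_G : forall v : T, 3 <= #|component e v|)
    (comp_Gc : forall v : T, 3 <= #|component (compl_graph e) v|)
    (cond :
      (diam_ge (diam e) 3 \/ diam_ge (diam (compl_graph e)) 3) \/
      (planar R e \/ planar R (compl_graph e)) \/
      (vertex_connectivity e <= 3 \/ vertex_connectivity (compl_graph e) <= 3) \/
      (~~ super_lambda e \/ ~~ super_lambda (compl_graph e))) :
  power_domination_number e * power_domination_number (compl_graph e)
    <= 2 * (n %/ 3).
Proof. by rewrite -order_n; exact: power_domination_product. Qed.
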